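(* For every real $\beta>0$, $$\int_{0}^{\infty}\frac{e^{-\tau}}{\tau^3}\left(\sqrt{\beta}\,\tau\,\mathrm{csch}\left(\sqrt{\beta}\,\tau\right)-1+\frac{\beta\tau^2}{6}\right)\mathrm{d}\tau=\frac{\beta\ln\beta}{12}-\frac{\ln\beta}{4}+\beta\left(\frac{\ln 4}{12}-\frac{1}{6}\right)-\frac{\ln 4}{4}-\frac14-4\beta\,\zeta^{(1,0)}\left(-1,\frac{1+\sqrt{\beta}}{2\sqrt{\beta}}\right).$$
   Context: $\mathrm{csch}(x)=1/\sinh(x)$. $\zeta(z,\nu)$ is the Hurwitz zeta function, i.e. the analytic continuation in $z$ of $\sum_{n=0}^{\infty}(n+\nu)^{-z}$ (convergent for $\mathrm{Re}\,z>1$, $\nu>0$) to $\mathbb{C}\setminus\{1\}$, and $\zeta^{(1,0)}(z,\nu)=\partial\zeta(z,\nu)/\partial z$ is its derivative with respect to the first argument. (The left-hand side is the function $f_0(\beta)$ giving the one-loop spin-0 Heisenberg-Euler Lagrangian $\frac{m^4}{16\pi^2}f_0(\beta)$ in a constant magnetic background.) *)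

(* Defs.v *)
From Stdlib Require Import Reals.
From Coquelicot Require Import Coquelicot.

Local Open Scope R_scope.

Definition csch (x : R) : R := 1 / sinh x.

(* x ^ s = exp (s ln x), principal value; meaningful for 0 < x only, since
   [ln] is 0 elsewhere. *)
Definition Rpow_C (x : R) (s : C) : C :=
  (exp (Re s * ln x) * cos (Im s * ln x),
   exp (Re s * ln x) * sin (Im s * ln x)).

Definition analytic_at (f : C -> C) (z0 : C) : Prop :=
  exists a : nat -> C,
    locally z0 (fun z : C =>
      @is_pseries C_AbsRing C_NormedModule a (z - z0)%C (f z)).

(* [zeta z nu] is the Hurwitz zeta function.  As the complex plane minus the
   point 1 is connected, the two clauses determine [zeta z nu] for all
   0 < nu and z <> 1; the values elsewhere are left unconstrained. *)
Definition is_Hurwitz_zeta (zeta : C -> R -> C) : Prop :=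
  forall nu : R, 0 < nu ->
    (forall z : C, z <> RtoC 1 -> analytic_at (fun w : C => zeta w nu) z) /\
    (forall z : C, 1 < Re z ->
       @is_series C_AbsRing C_NormedModule
         (fun n : nat => Rpow_C (INR n + nu) (- z)%C) (zeta z nu)).

(* Main.v *)
Require Import Defs.
From Stdlib Require Import Reals Arith Lra Lia Classical ClassicalEpsilon.
From Coquelicot Require Import Coquelicot.
Local Open Scope R_scope.

(** With s = sqrt beta, a = 1/(2s) and nu = a + 1/2, expanding csch as a geometric series turns the
    integral into 4 beta times a telescoping sum of Frullani integrals over the shifts
    a + n, whose terms are those of the midpoint Euler-Maclaurin formula for u ln u.

    On the zeta side, the partial sums of (z-1)(n+nu)^(-z) corrected by the midpoint
    Euler-Maclaurin terms at a + N converge to F(z) for |z-2| <= 4.  All of this is carried by a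
    single real power series of F around 2: the fifth-order Taylor remainder bounds the
    coefficients of the n-th term, weighted by 4^k, by a multiple of (a+n)^(-2).  The identity
    theorem, applied along an arc of parabola from 2 to -1 that avoids 1, gives
    (z-1) zeta(z,nu) = F(z) near -1, and differentiating F term by term at -1 yields the limit
    of the same telescoping sum. *)

(** * Exchanging the order of summation *)

(** Where the factor z - 1 comes from: with w = z - 2, the function u^(-(1+w)) = u^(1-z) has
    derivative -(z-1) u^(-z). Midpoint Euler-Maclaurin applied to it produces the terms
    (z-1)(n+nu)^(-z) without ever dividing by z - 1, so F is regular at 1. The radius 4 is a
    compromise. The disk around 2 has to contain the arc and, in its interior, the point -1, where w
    = -3, so that differentiation term by term is possible there. On the other side, the fifth
    derivative of u^(-(1+w)) has size u^(-6-w), which for |w| <= 4 is at worst u^(-2), still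
    summable. Without the second-derivative correction the third derivative would remain, of size up
    to u^0. The coefficients of F are real; complex numbers enter only through the identity theorem.
    On the integral side no infinite expansion is manipulated. With exp(-t) replaced by exp(-m t),
    passing from m to m + 2s multiplies csch(s t) by exp(-2 s t), and 1 - exp(-2 s t) cancels its
    denominator: the difference of two such integrands has an explicit primitive, and the integral
    left after N shifts is O(1/N). *)

Lemma norm_lim_le {K : AbsRing} {V : NormedModule K} (u : nat -> V) (l : V) (M : R) :
  filterlim u eventually (locally l) ->
  eventually (fun n => norm (u n) <= M) -> norm l <= M.
Proof.
  intros Hu Hb.
  apply (is_lim_seq_le_loc (fun n => norm (u n)) (fun _ => M) (norm l) M Hb).
  - apply (filterlim_comp _ _ _ _ _ _ _ _ Hu). apply filterlim_norm.
  - apply is_lim_seq_const.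
Qed.

Lemma filterlim_eps {K : AbsRing} {V : NormedModule K} (u : nat -> V) (l : V) :
  (forall eps : posreal, eventually (fun n => norm (minus (u n) l) < eps)) ->
  filterlim u eventually (locally l).
Proof.
  intros H. apply (filterlim_locally_ball_norm (F:=eventually)). exact H.
Qed.

Lemma filterlim_eps_rev {K : AbsRing} {V : NormedModule K} (u : nat -> V) (l : V) :
  filterlim u eventually (locally l) ->
  forall eps : posreal, eventually (fun n => norm (minus (u n) l) < eps).
Proof.
  intros H. exact (proj1 (filterlim_locally_ball_norm (F:=eventually) u l) H).
Qed.

Lemma ex_series_bounded (a : nat -> R) (M : R) :
  (forall n, 0 <= a n) -> (forall N, sum_n a N <= M) -> ex_series a.
Proof.
  intros Ha HM.
  destruct (ex_finite_lim_seq_incr (sum_n a) M) as [l Hl]; auto.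
  - intros n. rewrite sum_Sn. unfold plus; simpl. specialize (Ha (S n)). lra.
  - exists l. exact Hl.
Qed.

Lemma norm_sum_n {K : AbsRing} {V : NormedModule K} (u : nat -> V) (N : nat) :
  norm (sum_n u N) <= sum_n (fun n => norm (u n)) N.
Proof. apply norm_sum_n_m. Qed.

Lemma is_series_sum_n {K : AbsRing} {V : NormedModule K}
    (u : nat -> nat -> V) (c : nat -> V) (N : nat) :
  (forall k, is_series (fun n => u n k) (c k)) ->
  is_series (fun n => sum_n (u n) N) (sum_n c N).
Proof.
  intros H. induction N as [|N IH].
  - rewrite sum_O. apply is_series_ext with (2 := H 0%nat).
    intros n. now rewrite sum_O.
  - rewrite sum_Sn.
    apply is_series_ext with (2 := is_series_plus _ _ _ _ IH (H (S N))).
    intros n. now rewrite sum_Sn.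
Qed.

(** The error after k columns is the series over n of the row tails [d k n]. Finitely many of them
    become small together as k grows, and the others cost at most twice the tail of [M]. The space
    need not be complete, so the existence of [T] is assumed. *)
Lemma is_series_exchange {K : AbsRing} {V : NormedModule K}
    (u : nat -> nat -> V) (s c : nat -> V) (T : V) (M : nat -> R) :
  (forall n N, sum_n (fun k => norm (u n k)) N <= M n) -> ex_series M ->
  (forall n, is_series (u n) (s n)) ->
  (forall k, is_series (fun n => u n k) (c k)) ->
  is_series s T -> is_series c T.
Proof.
  intros Hb HM Hs Hc HT.
  assert (Hp : forall n N, norm (sum_n (u n) N) <= M n).
  { intros n N. eapply Rle_trans; [apply norm_sum_n | apply Hb]. }
  assert (HsM : forall n, norm (s n) <= M n).
  { intros n. apply (norm_lim_le _ _ _ (Hs n)). exists 0%nat. intros; apply Hp. }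
  apply filterlim_eps. intros eps.
  set (d := fun k n => minus (s n) (sum_n (u n) k)).
  assert (Hd : forall k n, norm (d k n) <= 2 * M n).
  { intros k n. unfold d, minus. eapply Rle_trans; [apply norm_triangle|].
    rewrite norm_opp. generalize (HsM n) (Hp n k). lra. }
  assert (H4 : 0 < eps / 4) by (generalize (cond_pos eps); lra).
  destruct (Cauchy_ex_series M HM (mkposreal _ H4)) as [N HN].
  assert (Hfin : forall N' (e : posreal),
            eventually (fun k => sum_n (fun n => norm (d k n)) N' < e)).
  { assert (H1 : forall n (e : posreal), eventually (fun k => norm (d k n) < e)).
    { intros n e. generalize (filterlim_eps_rev _ _ (Hs n) e).
      apply filter_imp. intros k Hk. unfold d.
      rewrite <- norm_opp, opp_minus. exact Hk. }
    induction N' as [|N' IH]; intros e.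
    - generalize (H1 0%nat e). apply filter_imp. intros k. now rewrite sum_O.
    - assert (He : 0 < e / 2) by (generalize (cond_pos e); lra).
      generalize (filter_and _ _ (IH (mkposreal _ He)) (H1 (S N') (mkposreal _ He))).
      apply filter_imp. intros k [Hk1 Hk2]. rewrite sum_Sn.
      unfold plus; simpl in *. lra. }
  generalize (Hfin N (mkposreal _ H4)). apply filter_imp. intros k Hk. simpl in Hk.
  assert (Hle : norm (minus T (sum_n c k)) <= 3 * (eps / 4)).
  { apply (norm_lim_le (sum_n (d k))).
    - apply (is_series_minus s (fun n => sum_n (u n) k)); [exact HT|].
      apply is_series_sum_n. exact Hc.
    - exists (S N). intros N' HN'. eapply Rle_trans; [apply norm_sum_n|].
      unfold sum_n. rewrite (sum_n_m_Chasles _ 0 N N') by lia.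
      apply Rle_trans with (eps / 4 + 2 * (eps / 4)); [|lra].
      unfold plus; simpl. apply Rplus_le_compat; [left; exact Hk|].
      apply Rle_trans with (sum_n_m (fun n => scal 2 (M n)) (S N) N').
      + apply sum_n_m_le. intros n. apply Hd.
      + rewrite sum_n_m_scal_l. unfold scal; simpl. unfold mult; simpl.
        apply Rmult_le_compat_l; [lra|].
        eapply Rle_trans; [apply Rle_abs|]. left. apply HN; lia. }
  rewrite <- norm_opp, opp_minus. simpl in *. generalize (cond_pos eps); lra.
Qed.

(** * Analytic functions and the identity theorem *)

Notation is_Cpseries := (@is_pseries C_AbsRing C_NormedModule).

Lemma Cmod_pow_n (z : C) (n : nat) : Cmod (@pow_n C_AbsRing z n) = Cmod z ^ n.
Proof.
  induction n as [|n IH].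
  - apply Cmod_1.
  - change (Cmod (Cmult z (@pow_n C_AbsRing z n)) = Cmod z ^ S n).
    now rewrite Cmod_mult, IH.
Qed.

Lemma Clocally_intro (z0 : C) (P : C -> Prop) (d : R) :
  0 < d -> (forall z, Cmod (z - z0)%C < d -> P z) -> locally z0 P.
Proof.
  intros Hd HP.
  apply (locally_le_locally_norm (V := C_NormedModule)).
  exists (mkposreal d Hd). intros z Hz. apply HP. exact Hz.
Qed.

Lemma Clocally_elim (z0 : C) (P : C -> Prop) :
  locally z0 P -> exists d, 0 < d /\ forall z, Cmod (z - z0)%C < d -> P z.
Proof.
  intros H. apply (locally_norm_le_locally (V := C_NormedModule)) in H.
  destruct H as [d Hd]. exists d. split; [apply cond_pos|].
  intros z Hz. apply Hd. exact Hz.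
Qed.

Lemma analytic_minus (f g : C -> C) (z0 : C) :
  analytic_at f z0 -> analytic_at g z0 -> analytic_at (fun z => f z - g z)%C z0.
Proof.
  intros [a Ha] [b Hb]. exists (PS_minus a b).
  generalize (filter_and _ _ Ha Hb). apply filter_imp. intros z [H1 H2].
  apply (is_pseries_minus (V := C_NormedModule) a b); assumption.
Qed.

(* The coefficients of (d + w) * sum a_k w^k. *)
Definition PS_linear_mul (d : C) (a : nat -> C) : nat -> C :=
  @PS_plus C_AbsRing C_NormedModule
    (@PS_scal C_AbsRing C_NormedModule d a) (@PS_incr_1 C_AbsRing C_NormedModule a).

Lemma is_pseries_linear_mul (d w l : C) (a : nat -> C) :
  is_Cpseries a w l -> is_Cpseries (PS_linear_mul d a) w ((d + w) * l)%C.
Proof.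
  intros H.
  replace ((d + w) * l)%C with (Cplus (Cmult d l) (Cmult w l)) by ring.
  apply (is_pseries_plus (V := C_NormedModule)).
  - apply (is_pseries_scal (V := C_NormedModule)); [|exact H].
    apply Cmult_comm.
  - apply (is_pseries_incr_1 (V := C_NormedModule)). exact H.
Qed.

Lemma analytic_linear_mul (c : C) (f : C -> C) (z0 : C) :
  analytic_at f z0 -> analytic_at (fun z => (z - c) * f z)%C z0.
Proof.
  intros [a Ha]. exists (PS_linear_mul (z0 - c)%C a).
  revert Ha. apply filter_imp. intros z Hz.
  replace (z - c)%C with ((z0 - c) + (z - z0))%C by ring.
  now apply is_pseries_linear_mul.
Qed.

(** Multiplying a power series by its variable costs a factor rho in the weighted l1 norm. This
    serves both the powers of d + w and the derivative majorants. *)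
Lemma sum_n_incr_le (b : nat -> R) (rho : R) (N : nat) :
  0 <= rho -> (forall j, 0 <= b j) ->
  sum_n (fun j => match j with O => 0 | S i => b i end * rho ^ j) N
    <= rho * sum_n (fun j => b j * rho ^ j) N.
Proof.
  intros Hr Hb.
  assert (Hp : forall j, 0 <= b j * rho ^ j).
  { intros j. apply Rmult_le_pos; [apply Hb | now apply pow_le]. }
  destruct N as [|N].
  - rewrite !sum_O. generalize (Rmult_le_pos _ _ Hr (Hp 0%nat)). simpl. lra.
  - assert (E : sum_n (fun j => match j with O => 0 | S i => b i end * rho ^ j) (S N)
              = rho * sum_n (fun j => b j * rho ^ j) N).
    { induction N as [|N IH].
      - rewrite sum_Sn, !sum_O. unfold plus; simpl. ring.
      - rewrite sum_Sn, IH, (sum_Sn _ N). unfold plus; simpl. ring. }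
    rewrite E. apply Rmult_le_compat_l; [exact Hr|].
    rewrite sum_Sn. unfold plus; simpl. generalize (Hp (S N)). simpl. lra.
Qed.

(** Coefficients in w of (d + w)^k, built by repeated multiplication by d + w rather than from
    binomial numbers, so that the sum and the bound follow by the same induction. *)
Fixpoint newton (d : C) (k : nat) : nat -> C :=
  match k with
  | O => fun j => match j with O => RtoC 1 | S _ => RtoC 0 end
  | S k => PS_linear_mul d (newton d k)
  end.

Lemma is_pseries_newton (d w : C) (k : nat) :
  is_Cpseries (newton d k) w (@pow_n C_AbsRing (d + w)%C k).
Proof.
  induction k as [|k IH].
  - apply (is_series_decr_1 (V := C_NormedModule)).
    apply is_series_ext with (fun _ : nat => zero (G := C_NormedModule)).
    + intros n. symmetry. apply (@scal_zero_r C_AbsRing C_NormedModule).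
    + simpl.
      replace (@plus _ (@one C_AbsRing) _) with (zero (G := C_NormedModule)).
      * apply filterlim_ext with (fun _ : nat => zero (G := C_NormedModule)).
        -- intros n. symmetry. apply (sum_n_m_const_zero (G := C_NormedModule)).
        -- apply filterlim_const.
      * rewrite (@scal_one C_AbsRing C_NormedModule). symmetry.
        apply (@plus_opp_r C_NormedModule).
  - apply is_pseries_linear_mul. exact IH.
Qed.

(** The weighted l1 norm is submultiplicative, and that of d + w is |d| + rho. *)
Lemma newton_bound (d : C) (rho : R) (k N : nat) : 0 <= rho ->
  sum_n (fun j => Cmod (newton d k j) * rho ^ j) N <= (Cmod d + rho) ^ k.
Proof.
  intros Hr. induction k as [|k IH].
  - simpl pow. induction N as [|N IHN].
    + rewrite sum_O. simpl. rewrite Cmod_1. lra.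
    + rewrite sum_Sn. simpl newton at 2. rewrite Cmod_0.
      unfold plus; simpl in *. lra.
  - apply Rle_trans with
      (sum_n (fun j => plus (scal (Cmod d) (Cmod (newton d k j) * rho ^ j))
         (match j with O => 0 | S i => Cmod (newton d k i) end * rho ^ j)) N).
    + apply sum_n_m_le. intros j.
      change (newton d (S k)) with (PS_linear_mul d (newton d k)).
      unfold plus, scal; simpl. unfold mult; simpl.
      rewrite <- Rmult_assoc, <- Rmult_plus_distr_r.
      apply Rmult_le_compat_r; [now apply pow_le|].
      rewrite <- Cmod_mult.
      destruct j as [|j].
      * eapply Rle_trans; [apply Cmod_triangle|].
        change (Cmod (d * newton d k 0)%C + Cmod (RtoC 0) <= Cmod (d * newton d k 0)%C + 0).
        rewrite Cmod_0. lra.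
      * apply Cmod_triangle.
    + rewrite sum_n_plus, sum_n_scal_l. simpl pow.
      unfold plus, scal; simpl. unfold mult; simpl.
      generalize (sum_n_incr_le (fun j => Cmod (newton d k j)) rho N Hr
                    (fun j => Cmod_ge_0 _)).
      intros H.
      apply Rle_trans with (Cmod d * sum_n (fun j => Cmod (newton d k j) * rho ^ j) N
         + rho * sum_n (fun j => Cmod (newton d k j) * rho ^ j) N).
      * apply Rplus_le_compat_l. exact H.
      * rewrite <- Rmult_plus_distr_r. apply Rmult_le_compat_l; [|exact IH].
        generalize (Cmod_ge_0 d). lra.
Qed.

Lemma Cmod_scal_pow (w a : C) (k : nat) :
  @norm C_AbsRing C_NormedModule (@scal C_AbsRing C_NormedModule (pow_n w k) a)
  = Cmod a * Cmod w ^ k.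
Proof.
  change (Cmod (Cmult (@pow_n C_AbsRing w k) a) = Cmod a * Cmod w ^ k).
  rewrite Cmod_mult, Cmod_pow_n. ring.
Qed.

Lemma term_le_sum_n (b : nat -> R) (n : nat) :
  (forall k, 0 <= b k) -> b n <= sum_n b n.
Proof.
  intros Hb. destruct n as [|n].
  - rewrite sum_O. lra.
  - rewrite sum_Sn. unfold plus; simpl.
    cut (0 <= sum_n b n); [lra|].
    induction n as [|n IH]; [rewrite sum_O; apply Hb|].
    rewrite sum_Sn. unfold plus; simpl. generalize (Hb (S n)). lra.
Qed.

(** [analytic_at] asks for a series centred at the point itself, so the series at z0 is re-expanded
    at z1: write z - z0 = d + w, expand each (d + w)^k and exchange the sums. As |d| + |w| < r, the
    double series is dominated by the given absolutely convergent one. *)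
Lemma analytic_pseries (a : nat -> C) (r : R) (z0 z1 : C) (f : C -> C) :
  ex_series (fun k => Cmod (a k) * r ^ k) ->
  (forall z, Cmod (z - z0)%C < r -> is_Cpseries a (z - z0)%C (f z)) ->
  Cmod (z1 - z0)%C < r -> analytic_at f z1.
Proof.
  intros Ha Hf Hz1. set (d := (z1 - z0)%C). fold d in Hz1.
  set (rho := r - Cmod d). assert (Hrho : 0 < rho) by (unfold rho; lra).
  assert (Hr : 0 < r) by (generalize (Cmod_ge_0 d); lra).
  assert (HA : forall j, exists A : C,
     @is_series C_AbsRing C_NormedModule (fun k => a k * newton d k j)%C A).
  { intros j.
    apply (ex_series_le (V := C_CompleteNormedModule) _
             (fun k => scal (/ rho ^ j) (Cmod (a k) * r ^ k))).
    - intros k. change (Cmod (a k * newton d k j)%C <= / rho ^ j * (Cmod (a k) * r ^ k)).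
      rewrite Cmod_mult.
      assert (Hj : Cmod (newton d k j) * rho ^ j <= r ^ k).
      { replace r with (Cmod d + rho) by (unfold rho; ring).
        apply Rle_trans with (2 := newton_bound d rho k j (Rlt_le _ _ Hrho)).
        apply (term_le_sum_n (fun j => Cmod (newton d k j) * rho ^ j)).
        intros i. apply Rmult_le_pos; [apply Cmod_ge_0 | apply pow_le; lra]. }
      assert (Hp : 0 < rho ^ j) by now apply pow_lt.
      apply Rmult_le_reg_r with (rho ^ j); [exact Hp|].
      replace (/ rho ^ j * (Cmod (a k) * r ^ k) * rho ^ j) with (Cmod (a k) * r ^ k)
        by (field; lra).
      rewrite Rmult_assoc. apply Rmult_le_compat_l; [apply Cmod_ge_0 | exact Hj].
    - exact (ex_series_scal (V := R_NormedModule) (/ rho ^ j) _ Ha). }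
  set (A := fun j => proj1_sig (constructive_indefinite_description _ (HA j))).
  assert (HA' : forall j,
     @is_series C_AbsRing C_NormedModule (fun k => a k * newton d k j)%C (A j)).
  { intros j. unfold A. now destruct (constructive_indefinite_description _ (HA j)). }
  exists A. apply Clocally_intro with (1 := Hrho). intros z Hz.
  set (w := (z - z1)%C). fold w in Hz.
  assert (Hdw : (z - z0 = d + w)%C) by (unfold d, w; ring).
  assert (Hdw' : Cmod d + Cmod w < r) by (unfold rho in Hz; lra).
  apply (is_series_exchange (V := C_NormedModule)
     (fun k j => scal (pow_n (w : C_AbsRing) j) (a k * newton d k j)%C)
     (fun k => scal (pow_n ((d + w)%C : C_AbsRing) k) (a k)) _ _
     (fun k => Cmod (a k) * r ^ k)).
  - intros k N.
    apply Rle_trans with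
      (sum_n (fun j => scal (Cmod (a k)) (Cmod (newton d k j) * Cmod w ^ j)) N).
    + apply sum_n_m_le. intros j. rewrite Cmod_scal_pow, Cmod_mult.
      right. unfold scal; simpl. unfold mult; simpl. ring.
    + rewrite sum_n_scal_l. unfold scal; simpl. unfold mult; simpl.
      apply Rmult_le_compat_l; [apply Cmod_ge_0|].
      eapply Rle_trans; [apply newton_bound, Cmod_ge_0|].
      apply pow_incr. split; [|lra].
      generalize (Cmod_ge_0 d) (Cmod_ge_0 w); lra.
  - exact Ha.
  - intros k.
    generalize (is_series_scal (V := C_NormedModule) (a k) _ _ (is_pseries_newton d w k)).
    intros H.
    replace (scal (pow_n ((d + w)%C : C_AbsRing) k) (a k))
      with (scal (a k : C_AbsRing) (pow_n ((d + w)%C : C_AbsRing) k)) by apply Cmult_comm.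
    apply is_series_ext with (2 := H). intros j.
    unfold scal; simpl. unfold mult; simpl. ring.
  - intros j. apply (is_series_scal (V := C_NormedModule)). apply HA'.
  - rewrite <- Hdw. apply Hf. rewrite Hdw.
    eapply Rle_lt_trans; [apply Cmod_triangle | exact Hdw'].
Qed.

(** All coefficients vanish, by strong induction. If a_m were the first nonzero one, a zero at small
    distance |w| would give |a_m w^m| <= sum over k > m of |a_k w^k|, which is of order
    |w|^(m+1). *)
Lemma analytic_isolated_zeros (f : C -> C) (z0 : C) :
  analytic_at f z0 ->
  (forall d, 0 < d -> exists z, z <> z0 /\ Cmod (z - z0)%C < d /\ f z = RtoC 0) ->
  locally z0 (fun z => f z = RtoC 0).
Proof.
  intros [a Ha] Hz. apply Clocally_elim in Ha. destruct Ha as [r [Hr Ha]].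
  set (rho := r / 2). assert (Hrho : 0 < rho) by (unfold rho; lra).
  (* Convergence at the real displacement rho, strictly inside the disk, makes the terms bounded
     there. *)
  assert (HB : exists B, 0 < B /\ forall k, Cmod (a k) * rho ^ k <= B).
  { assert (Hc : Cmod (RtoC rho) = rho) by (rewrite Cmod_R; apply Rabs_pos_eq; lra).
    assert (Hs : is_Cpseries a (RtoC rho) (f (z0 + RtoC rho)%C)).
    { replace (RtoC rho) with ((z0 + RtoC rho) - z0)%C at 1 by ring.
      apply Ha. replace ((z0 + RtoC rho) - z0)%C with (RtoC rho) by ring.
      rewrite Hc. unfold rho; lra. }
    destruct (filterlim_bounded (V := C_NormedModule) _ (ex_intro _ _ Hs)) as [M HM].
    assert (HM0 : 0 <= M)
      by (eapply Rle_trans; [apply (norm_ge_0 (V := C_NormedModule)) | apply (HM 0%nat)]).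
    exists (2 * M + 1). split; [lra|]. intros k.
    pattern rho at 1. rewrite <- Hc. rewrite <- Cmod_scal_pow.
    destruct k as [|k].
    - assert (H := HM 0%nat). rewrite sum_O in H.
      eapply Rle_trans; [exact H | lra].
    - generalize (HM k) (HM (S k)). rewrite sum_Sn.
      set (x := sum_n _ k). set (y := scal _ _). intros H1 H2.
      replace y with (minus (plus x y) x).
      + unfold minus. eapply Rle_trans; [apply (norm_triangle (V := C_NormedModule))|].
        rewrite (norm_opp (V := C_NormedModule)). lra.
      + change (((x : C) + y - x)%C = y). ring. }
  destruct HB as [B [HB0 HB]].
  assert (H0 : forall m, a m = RtoC 0).
  { induction m as [m IH] using (well_founded_induction lt_wf).
    apply NNPP. intros Hm. apply Cmod_gt_0 in Hm.
    assert (Hpm : 0 < rho ^ S m) by now apply pow_lt.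
    (* The first bound gives t <= 1/2; the second contradicts |a_m| <= 2 B |w| / rho^(m+1), the
       estimate to be drawn from f z = 0. *)
    set (d := Rmin (rho / 2) (Cmod (a m) * rho ^ S m / (2 * B))).
    assert (Hd : 0 < d).
    { unfold d. apply Rmin_glb_lt; [lra|]. apply Rdiv_lt_0_compat; [|lra].
      now apply Rmult_lt_0_compat. }
    destruct (Hz d Hd) as [z [Hne [Hzd Hfz]]].
    set (w := (z - z0)%C). fold w in Hzd.
    assert (Hw0 : 0 < Cmod w).
    { apply -> Cmod_gt_0. intros E. apply Hne.
      replace z with (w + z0)%C by (unfold w; ring). rewrite E. ring. }
    assert (Hd1 : Cmod w < rho / 2) by (eapply Rlt_le_trans; [exact Hzd | apply Rmin_l]).
    assert (Hd2 : Cmod w < Cmod (a m) * rho ^ S m / (2 * B))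
      by (eapply Rlt_le_trans; [exact Hzd | apply Rmin_r]).
    set (t := Cmod w / rho).
    assert (Ht : 0 < t <= / 2).
    { unfold t. split; [now apply Rdiv_lt_0_compat|].
      apply Rmult_le_reg_r with rho; [exact Hrho|]. unfold Rdiv.
      rewrite Rmult_assoc, Rinv_l by lra. lra. }
    assert (Hterm : forall k, Cmod (a k) * Cmod w ^ k <= B * t ^ k).
    { intros k. replace (Cmod w) with (rho * t) by (unfold t; field; lra).
      rewrite Rpow_mult_distr, <- Rmult_assoc.
      apply Rmult_le_compat_r; [apply pow_le; lra | apply HB]. }
    set (S_ := sum_n (fun k => scal (pow_n (w : C_AbsRing) k) (a k : C_NormedModule))).
    set (am := scal (pow_n (w : C_AbsRing) m) (a m : C_NormedModule)).
    assert (HSm : S_ m = am).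
    { unfold S_, am. destruct m as [|m]; [apply sum_O|].
      rewrite sum_Sn.
      rewrite (sum_n_ext_loc _ (fun _ => zero (G := C_NormedModule))).
      - unfold sum_n. rewrite sum_n_m_const_zero. apply plus_zero_l.
      - intros n Hn. rewrite IH by lia. apply (@scal_zero_r C_AbsRing C_NormedModule). }
    (* As t <= 1/2, each term B t^(N+1) is at most 2 B (t^(N+1) - t^(N+2)), so the bound
       telescopes. *)
    assert (Hbd : forall N, (m <= N)%nat ->
               norm (minus (S_ N) am) <= 2 * B * (t ^ S m - t ^ S N)).
    { intros N HN. induction HN as [|N HN IHN].
      - rewrite HSm, minus_eq_zero.
        apply Rle_trans with 0; [right; exact (norm_zero (V := C_NormedModule)) | lra].
      - unfold S_. rewrite sum_Sn. fold (S_ N). set (y := scal _ _).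
        replace (minus (plus (S_ N) y) am) with (plus (minus (S_ N) am) y).
        + eapply Rle_trans; [apply (norm_triangle (V := C_NormedModule))|].
          assert (Hy : norm y <= B * t ^ S N).
          { unfold y. rewrite Cmod_scal_pow. apply Hterm. }
          assert (Htp : 0 <= t ^ S N) by (apply pow_le; lra).
          replace (t ^ S (S N)) with (t * t ^ S N) by reflexivity.
          assert (0 <= B * t ^ S N * (1 - 2 * t)).
          { apply Rmult_le_pos; [apply Rmult_le_pos|]; lra. }
          lra.
        + change (((S_ N : C) - am + y)%C = (S_ N + y - am)%C). ring. }
    assert (Hlim : norm (minus (zero : C_NormedModule) am) <= 2 * B * t ^ S m).
    { apply (norm_lim_le (fun N => minus (S_ N) am)).
      - apply (filterlim_comp_2 (G := locally (zero : C_NormedModule)) (H := locally (opp am))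
                 S_ (fun _ => opp am) plus).
        + assert (Hza : Cmod (z - z0)%C < r) by (fold w; unfold rho in Hd1; lra).
          apply Ha in Hza. rewrite Hfz in Hza. exact Hza.
        + apply filterlim_const.
        + apply (filterlim_plus (V := C_NormedModule)).
      - exists m. intros N HN. eapply Rle_trans; [apply Hbd, HN|].
        assert (0 <= t ^ S N) by (apply pow_le; lra).
        apply Rmult_le_compat_l; lra. }
    unfold minus in Hlim. rewrite plus_zero_l, (norm_opp (V := C_NormedModule)) in Hlim.
    unfold am in Hlim. rewrite Cmod_scal_pow in Hlim.
    replace (2 * B * t ^ S m)
      with ((2 * B * Cmod w / rho ^ S m) * Cmod w ^ m) in Hlim.
    2:{ unfold t, Rdiv. rewrite Rpow_mult_distr, pow_inv. simpl. field.
        split; [apply pow_nonzero|]; lra. }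
    apply Rmult_le_reg_r in Hlim; [|now apply pow_lt].
    apply (Rmult_lt_compat_r (2 * B / rho ^ S m)) in Hd2.
    2:{ apply Rdiv_lt_0_compat; lra. }
    replace (Cmod (a m) * rho ^ S m / (2 * B) * (2 * B / rho ^ S m))
      with (Cmod (a m)) in Hd2 by (field; lra).
    replace (Cmod w * (2 * B / rho ^ S m)) with (2 * B * Cmod w / rho ^ S m) in Hd2
      by (field; lra).
    lra. }
  apply Clocally_intro with (1 := Hr). intros z Hzr.
  apply (filterlim_locally_unique (V := C_NormedModule) (F := eventually)
     (sum_n (fun k => scal (pow_n ((z - z0)%C : C_AbsRing) k) (a k : C_NormedModule)))).
  - apply Ha, Hzr.
  - apply filterlim_ext with (fun _ : nat => zero (G := C_NormedModule)).
    + intros n. symmetry.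
      rewrite (sum_n_ext _ (fun _ => zero (G := C_NormedModule))).
      * unfold sum_n. apply sum_n_m_const_zero.
      * intros k. rewrite H0. apply (@scal_zero_r C_AbsRing C_NormedModule).
    + apply filterlim_const.
Qed.

(** A graph over the real axis through -1 and 2, at height 2 above the point 1. Different parameters
    give different points, so zeros on one side of a parameter do accumulate at its point. *)
Definition parabola (t : R) : C := (t, (t + 1) * (2 - t)).

Lemma parabola_near (t0 d : R) : 0 < d ->
  exists e, 0 < e /\ forall t, Rabs (t - t0) < e -> Cmod (parabola t - parabola t0)%C < d.
Proof.
  intros Hd.
  assert (Hc : continuous (fun t : R => (t + 1) * (2 - t)) t0).
  { apply (ex_derive_continuous (V := R_NormedModule)). auto_derive. trivial. }
  assert (Hd2 : 0 < d / 2) by lra.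
  destruct (proj1 (filterlim_locally_ball_norm (U := R_NormedModule) _ _) Hc
              (mkposreal _ Hd2)) as [e1 He1].
  exists (Rmin e1 (d / 2)). split.
  - apply Rmin_glb_lt; [apply cond_pos | lra].
  - intros t Ht.
    assert (H1 : Rabs (t - t0) < e1) by (eapply Rlt_le_trans; [exact Ht | apply Rmin_l]).
    assert (H2 : Rabs (t - t0) < d / 2) by (eapply Rlt_le_trans; [exact Ht | apply Rmin_r]).
    specialize (He1 t H1).
    change (Rabs ((t + 1) * (2 - t) - (t0 + 1) * (2 - t0)) < d / 2) in He1.
    replace (parabola t - parabola t0)%C
      with (RtoC (t - t0) + Ci * RtoC ((t + 1) * (2 - t) - (t0 + 1) * (2 - t0)))%C.
    + eapply Rle_lt_trans; [apply Cmod_triangle|].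
      rewrite Cmod_mult, Cmod_Ci, !Cmod_R. lra.
    + unfold parabola, RtoC, Ci, Cplus, Cminus, Cmult, Copp.
      apply injective_projections; simpl; ring.
Qed.

(* The arc avoids the possible singularity at 1. *)
Lemma analytic_zero_on_parabola (f : C -> C) :
  (forall t, -1 <= t <= 2 -> analytic_at f (parabola t)) ->
  (forall x, 1 < x < 3 -> f (RtoC x) = RtoC 0) ->
  locally (RtoC (-1)) (fun z => f z = RtoC 0).
Proof.
  intros Hf Hx.
  set (P := fun t => locally (parabola t) (fun z => f z = RtoC 0)).
  assert (H2 : P 2).
  { apply analytic_isolated_zeros; [apply Hf; lra|].
    intros d Hd. exists (RtoC (2 + Rmin (d / 2) (1 / 2))).
    assert (0 < Rmin (d / 2) (1 / 2)) by (apply Rmin_glb_lt; lra).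
    generalize (Rmin_l (d / 2) (1 / 2)) (Rmin_r (d / 2) (1 / 2)). intros Hl Hr.
    set (h := Rmin (d / 2) (1 / 2)) in *.
    repeat split.
    - unfold parabola, RtoC. intros E. injection E. lra.
    - replace (RtoC (2 + h) - parabola 2)%C with (RtoC h).
      + rewrite Cmod_R, Rabs_pos_eq; lra.
      + unfold parabola, RtoC, Cminus, Cplus, Copp. apply injective_projections; simpl; ring.
    - apply Hx. lra. }
  assert (Hopen : forall t, P t -> exists e, 0 < e /\
             forall u, Rabs (u - t) < e -> P u).
  { intros t Ht. apply Clocally_elim in Ht. destruct Ht as [d [Hd Ht]].
    destruct (parabola_near t (d / 2)) as [e [He Hp]]; [lra|].
    exists e. split; [exact He|]. intros u Hu.
    apply Clocally_intro with (d / 2); [lra|]. intros z Hz. apply Ht.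
    replace (z - parabola t)%C
      with ((z - parabola u) + (parabola u - parabola t))%C by ring.
    eapply Rle_lt_trans; [apply Cmod_triangle|]. specialize (Hp u Hu). lra. }
  replace (RtoC (-1)) with (parabola (-1)).
  2:{ unfold parabola, RtoC. apply injective_projections; simpl; ring. }
  fold (P (-1)). apply NNPP. intros Hneg.
  (* Parameters above the supremum s of the bad ones are good, so s is 2 or a limit of zeros, hence
     good itself. Openness then makes a neighbourhood of s good, and s - e/2 is a smaller upper
     bound. *)
  set (bad := fun t => -1 <= t <= 2 /\ ~ P t).
  destruct (completeness bad) as [s [Hub Hlub]].
  - exists 2. intros t [Ht _]. lra.
  - exists (-1). split; [lra | exact Hneg].
  - assert (Hs1 : -1 <= s) by (apply Hub; split; [lra | exact Hneg]).
    assert (Hs2 : s <= 2) by (apply Hlub; intros t [Ht _]; lra).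
    assert (Habove : forall t, s < t <= 2 -> P t).
    { intros t Ht. apply NNPP. intros Hn. cut (t <= s); [lra|].
      apply Hub. split; [lra | exact Hn]. }
    assert (HPs : P s).
    { destruct (Req_dec s 2) as [-> | Hne]; [exact H2|].
      apply analytic_isolated_zeros; [apply Hf; lra|].
      intros d Hd. destruct (parabola_near s d Hd) as [e [He Hp]].
      exists (parabola (s + Rmin (e / 2) (2 - s))).
      assert (0 < Rmin (e / 2) (2 - s)) by (apply Rmin_glb_lt; lra).
      generalize (Rmin_l (e / 2) (2 - s)) (Rmin_r (e / 2) (2 - s)). intros Hl Hr.
      set (h := Rmin (e / 2) (2 - s)) in *.
      repeat split.
      - unfold parabola. intros E. injection E. lra.
      - apply Hp. rewrite Rabs_pos_eq; lra.
      - apply (locally_singleton _ _ (Habove (s + h) ltac:(lra))). }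
    destruct (Hopen s HPs) as [e [He Hop]].
    cut (s <= s - e / 2); [lra|].
    apply Hlub. intros t [Ht Hnt]. apply Rnot_lt_le. intros Hlt.
    apply Hnt, Hop. assert (t <= s) by (apply Hub; now split).
    apply Rabs_def1; lra.
Qed.

(** * From a real power series to the derivative at -1 *)

Lemma sum_n_RtoC (a : nat -> R) (N : nat) :
  sum_n (fun n => RtoC (a n) : C_NormedModule) N = RtoC (sum_n a N).
Proof.
  induction N as [|N IH]; [now rewrite !sum_O|].
  rewrite !sum_Sn, IH. symmetry. apply RtoC_plus.
Qed.

Lemma is_series_RtoC (a : nat -> R) (l : R) :
  is_series a l -> @is_series C_AbsRing C_NormedModule (fun n => RtoC (a n)) (RtoC l).
Proof.
  intros H. apply filterlim_eps. intros eps.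
  generalize (filterlim_eps_rev _ _ H eps). apply filter_imp. intros N HN.
  rewrite sum_n_RtoC.
  change (Cmod (RtoC (sum_n a N) - RtoC l)%C < eps).
  rewrite <- RtoC_minus, Cmod_R. exact HN.
Qed.

Lemma is_Cseries_unique (a : nat -> C) (l1 l2 : C) :
  @is_series C_AbsRing C_NormedModule a l1 ->
  @is_series C_AbsRing C_NormedModule a l2 -> l1 = l2.
Proof.
  apply (filterlim_locally_unique (V := C_NormedModule) (F := eventually)).
Qed.

Lemma Rpow_C_real (x y : R) : Rpow_C x (RtoC y) = RtoC (exp (y * ln x)).
Proof.
  unfold Rpow_C, RtoC. simpl. rewrite Rmult_0_l, cos_0, sin_0.
  f_equal; ring.
Qed.

Lemma pow_n_RtoC (x : R) (k : nat) : @pow_n C_AbsRing (RtoC x) k = RtoC (x ^ k).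
Proof.
  induction k as [|k IH]; [reflexivity|].
  simpl. rewrite IH, RtoC_mult. reflexivity.
Qed.

Lemma is_pseries_RtoC (c : nat -> R) (x l : R) :
  is_series (fun k => c k * x ^ k) l ->
  is_Cpseries (fun k => RtoC (c k)) (RtoC x) (RtoC l).
Proof.
  intros H. apply is_series_RtoC in H.
  apply is_series_ext with (2 := H). intros k.
  rewrite pow_n_RtoC, RtoC_mult. apply Cmult_comm.
Qed.

Lemma is_lim_difference_quotient (h : R -> R) (x0 l : R) :
  is_derive h x0 l -> is_lim (fun x => (h x - h x0) / (x - x0)) x0 l.
Proof.
  intros H. apply is_derive_Reals in H. apply is_lim_spec. intros eps.
  destruct (H eps (cond_pos eps)) as [d Hd]. exists d. intros x Hx Hne.
  specialize (Hd (x - x0)). rewrite Rplus_minus in Hd.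
  apply Hd; [lra | exact Hx].
Qed.

(** [C_lim] takes its limit along the horizontal line through the point only. For a function that is
    real on the real axis near x0, the complex derivative is therefore the real one. *)
Lemma C_derive_real (f : C -> C) (h : R -> R) (x0 l : R) :
  locally x0 (fun x => f (RtoC x) = RtoC (h x)) -> is_derive h x0 l ->
  C_derive f (RtoC x0) = RtoC l.
Proof.
  intros Hf Hd.
  assert (Hq : Rbar_locally' x0 (fun x =>
      ((f (RtoC x) - f (RtoC x0)) / (RtoC x - RtoC x0))%C
        = RtoC ((h x - h x0) / (x - x0)))).
  { assert (H0 := locally_singleton _ _ Hf). simpl in H0.
    unfold Rbar_locally', locally', within. revert Hf. apply filter_imp.
    intros x Hx Hne. rewrite Hx, H0, <- !RtoC_minus, <- RtoC_div; [reflexivity|lra]. }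
  unfold C_derive, C_lim. apply injective_projections.
  - change (real (Lim (fun x => fst ((f (RtoC x) - f (RtoC x0)) / (RtoC x - RtoC x0))%C) x0)
            = l).
    rewrite (is_lim_unique _ x0 l); [reflexivity|].
    apply is_lim_ext_loc with (2 := is_lim_difference_quotient h x0 l Hd).
    revert Hq. apply filter_imp. intros x Hx.
    now rewrite Hx.
  - change (real (Lim (fun x => snd ((f (RtoC x) - f (RtoC x0)) / (RtoC x - RtoC x0))%C) x0)
            = 0).
    rewrite (is_lim_unique _ x0 0); [reflexivity|].
    apply is_lim_ext_loc with (fun _ => 0); [|apply is_lim_const].
    revert Hq. apply filter_imp. intros x Hx.
    now rewrite Hx.
Qed.

Lemma parabola_disk (t : R) : -1 <= t <= 2 -> Cmod (parabola t - RtoC 2)%C < 4.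
Proof.
  intros Ht. unfold Cmod. rewrite <- (sqrt_pow2 4) by lra.
  apply sqrt_lt_1_alt. split; [apply Rplus_le_le_0_compat; apply pow2_ge_0|].
  replace (fst (parabola t - RtoC 2)%C) with (t - 2) by reflexivity.
  replace (snd (parabola t - RtoC 2)%C) with ((t + 1) * (2 - t)) by (simpl; ring).
  assert (H : 0 <= (t + 1) * (2 - t) <= 9 / 4).
  { split; [apply Rmult_le_pos; lra | generalize (pow2_ge_0 (t - 1 / 2)); nra]. }
  assert (((t + 1) * (2 - t)) ^ 2 <= (9 / 4) ^ 2) by (apply pow_incr; exact H).
  nra.
Qed.

(** Both (z-1) zeta(z,nu) and the sum F of the series are analytic along the arc and agree for real
    1 < x < 3, hence near -1. The right-hand side is the quotient rule for F(x)/(x-1) at x = -1,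
    where x - 2 = -3. *)
Lemma hurwitz_derive_minus_one (zeta : C -> R -> C) (nu : R) (c : nat -> R) :
  is_Hurwitz_zeta zeta -> 0 < nu ->
  ex_series (fun k => Rabs (c k) * 4 ^ k) ->
  (forall x, 1 < x < 3 ->
     is_series (fun n => (x - 1) * exp (- x * ln (INR n + nu))) (PSeries c (x - 2))) ->
  C_derive (fun z => zeta z nu) (RtoC (-1))
    = RtoC (- PSeries (PS_derive c) (-3) / 2 - PSeries c (-3) / 4).
Proof.
  intros Hzeta Hnu Hc Hsum. destruct (Hzeta nu Hnu) as [Han Hser].
  assert (Hex : forall z : C, exists v, Cmod (z - RtoC 2)%C < 4 ->
             is_Cpseries (fun k => RtoC (c k)) (z - RtoC 2)%C v).
  { intros z. destruct (Rlt_dec (Cmod (z - RtoC 2)%C) 4) as [Hz|Hz].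
    - destruct (ex_series_le (V := C_CompleteNormedModule)
        (fun k => scal (pow_n ((z - RtoC 2)%C : C_AbsRing) k) (RtoC (c k) : C_NormedModule))
        (fun k => Rabs (c k) * 4 ^ k)) as [v Hv].
      + intros k.
        eapply Rle_trans; [right; exact (Cmod_scal_pow (z - RtoC 2)%C (RtoC (c k)) k)|].
        rewrite Cmod_R. apply Rmult_le_compat_l; [apply Rabs_pos|].
        apply pow_incr. split; [apply Cmod_ge_0 | lra].
      + exact Hc.
      + exists v. intros _. exact Hv.
    - exists (RtoC 0). intros H. contradiction. }
  (* The sum of the series inside the disk of radius 4; outside it the chosen value is arbitrary. *)
  set (F := fun z => proj1_sig (constructive_indefinite_description _ (Hex z))).
  assert (HF : forall z, Cmod (z - RtoC 2)%C < 4 ->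
             is_Cpseries (fun k => RtoC (c k)) (z - RtoC 2)%C (F z)).
  { intros z. unfold F. now destruct (constructive_indefinite_description _ (Hex z)). }
  assert (Hrad : Rbar_le 4 (CV_radius c)).
  { apply (proj1 (CV_radius_bounded c)).
    assert (Hl := ex_series_lim_0 _ Hc).
    destruct (filterlim_bounded (V := R_NormedModule) (fun k => Rabs (c k) * 4 ^ k)
              (ex_intro (fun y : R => filterlim _ eventually (locally y)) 0 Hl)) as [M HM].
    exists M. intros n. rewrite Rabs_mult, (Rabs_pos_eq (4 ^ n)) by (apply pow_le; lra).
    eapply Rle_trans; [apply Rle_abs | apply (HM n)]. }
  assert (HFr : forall x, Rabs (x - 2) < 4 -> F (RtoC x) = RtoC (PSeries c (x - 2))).
  { intros x Hx.
    assert (Hx' : Cmod (RtoC x - RtoC 2)%C < 4) by now rewrite <- RtoC_minus, Cmod_R.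
    apply HF in Hx'. apply (is_Cseries_unique _ _ _ Hx').
    rewrite <- RtoC_minus. apply is_pseries_RtoC.
    apply is_series_ext with (fun k => scal (pow_n (x - 2) k) (c k)).
    - intros k. rewrite pow_n_pow. apply Rmult_comm.
    - apply PSeries_correct. apply CV_radius_inside.
      eapply Rbar_lt_le_trans; [|exact Hrad]. exact Hx. }
  assert (HD : locally (RtoC (-1)) (fun z => ((z - RtoC 1) * zeta z nu - F z)%C = RtoC 0)).
  { apply analytic_zero_on_parabola.
    - intros t Ht. apply analytic_minus.
      + apply analytic_linear_mul. apply Han. intros E. injection E. nra.
      + apply (analytic_pseries (fun k => RtoC (c k)) 4 (RtoC 2)).
        * apply ex_series_ext with (2 := Hc). intros k. now rewrite Cmod_R.
        * exact HF.
        * now apply parabola_disk.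
    - intros x Hx. rewrite HFr by (apply Rabs_def1; lra).
      assert (E : RtoC (PSeries c (x - 2)) = ((RtoC x - RtoC 1) * zeta (RtoC x) nu)%C).
      { apply (is_Cseries_unique _ _ _ (is_series_RtoC _ _ (Hsum x Hx))).
        assert (Hx1 : 1 < Re (RtoC x)) by (simpl; lra).
        apply Hser in Hx1.
        apply (is_series_scal (V := C_NormedModule) (RtoC x - RtoC 1)%C) in Hx1.
        apply is_series_ext with (2 := Hx1). intros n.
        rewrite <- RtoC_opp, Rpow_C_real, <- RtoC_minus, RtoC_mult. reflexivity. }
      rewrite E. ring. }
  apply (C_derive_real _ (fun x => PSeries c (x - 2) / (x - 1))).
  - apply Clocally_elim in HD. destruct HD as [d [Hd HD]].
    assert (Hm : 0 < Rmin d 1) by (apply Rmin_glb_lt; lra).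
    exists (mkposreal _ Hm). intros x Hx.
    change (Rabs (x - (-1)) < Rmin d 1) in Hx.
    assert (H1 : Rabs (x - -1) < d) by (eapply Rlt_le_trans; [exact Hx | apply Rmin_l]).
    assert (H2 : Rabs (x - -1) < 1) by (eapply Rlt_le_trans; [exact Hx | apply Rmin_r]).
    apply Rabs_def2 in H2.
    specialize (HD (RtoC x)). rewrite <- RtoC_minus, Cmod_R in HD. specialize (HD H1).
    rewrite HFr in HD by (apply Rabs_def1; lra).
    assert (Hne : x - 1 <> 0) by lra.
    rewrite RtoC_div by exact Hne.
    assert (HneC : RtoC (x - 1) <> RtoC 0) by (intros E; injection E; lra).
    rewrite <- RtoC_minus in HD.
    replace (RtoC (PSeries c (x - 2))) with (RtoC (x - 1) * zeta (RtoC x) nu)%C.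
    + field. exact HneC.
    + rewrite <- (Cplus_0_l (RtoC (PSeries c (x - 2)))), <- HD. ring.
  - assert (Hdp : is_derive (PSeries c) (-1 - 2) (PSeries (PS_derive c) (-1 - 2))).
    { apply is_derive_PSeries. eapply Rbar_lt_le_trans; [|exact Hrad].
      change (Rabs (-1 - 2) < 4). apply Rabs_def1; lra. }
    replace (-1 - 2) with (-3) in Hdp by ring.
    assert (He : ex_derive (PSeries c) (-1 + -2)).
    { replace (-1 + -2) with (-3) by ring. eexists; exact Hdp. }
    auto_derive.
    + split; [exact He|]. split; [lra | trivial].
    + replace (-1 + - (2)) with (-3) by ring.
      replace (Derive (fun x : R => PSeries c x) (-3)) with (PSeries (PS_derive c) (-3)).
      * field.
      * symmetry. now apply is_derive_unique.
Qed.

(** * Midpoint Euler-Maclaurin remainders *)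

(** A family [f i], each the derivative of the preceding one on the positive half-line, stands for a
    function with its iterated derivatives. Taylor's formula can then be used on explicit
    expressions. *)
Lemma chain_is_derive_n (f : nat -> R -> R) (m : nat) (t : R) :
  (forall i u, 0 < u -> is_derive (f i) u (f (S i) u)) -> 0 < t ->
  is_derive_n (f 0%nat) m t (f m t).
Proof.
  intros Hf. revert t. induction m as [|m IH]; intros t Ht; [reflexivity|].
  simpl. apply is_derive_ext_loc with (f m); [|now apply Hf].
  exists (mkposreal t Ht). intros u Hu. symmetry. apply is_derive_n_unique, IH.
  change (Rabs (u - t) < t) in Hu. apply Rabs_def2 in Hu. lra.
Qed.

Lemma chain_taylor (f : nat -> R -> R) (n : nat) (y h : R) :
  (forall i u, 0 < u -> is_derive (f i) u (f (S i) u)) -> 0 < y -> 0 < h ->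
  exists xi, y < xi < y + h /\
    f 0%nat (y + h) = sum_f_R0 (fun m => h ^ m / INR (fact m) * f m y) n
      + h ^ S n / INR (fact (S n)) * f (S n) xi.
Proof.
  intros Hf Hy Hh.
  destruct (Taylor_Lagrange (f 0%nat) n y (y + h)) as [xi [Hxi E]]; [lra| |].
  - intros t Ht k _. destruct k as [|k]; [exact I|].
    eexists. apply (chain_is_derive_n f (S k) t Hf). lra.
  - exists xi. split; [exact Hxi|]. rewrite E.
    replace (y + h - y) with h by ring. f_equal.
    + apply sum_eq. intros i _. f_equal.
      apply is_derive_n_unique, chain_is_derive_n; assumption.
    + f_equal. apply is_derive_n_unique, chain_is_derive_n; [assumption | lra].
Qed.

(* The weights make the Taylor terms of orders 1 to 4 at y cancel. *)
Lemma midpoint_euler_maclaurin_bound (f : nat -> R -> R) (y B : R) :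
  (forall i u, 0 < u -> is_derive (f i) u (f (S i) u)) -> 0 < y ->
  (forall u, y <= u <= y + 1 -> Rabs (f 5%nat u) <= B) ->
  Rabs (- f 1%nat (y + / 2) + (f 0%nat (y + 1) - f 0%nat y)
        - (f 2%nat (y + 1) - f 2%nat y) / 24) <= B.
Proof.
  intros Hf Hy HB.
  destruct (chain_taylor f 4 y 1 Hf Hy ltac:(lra)) as [x0 [Hx0 E0]].
  destruct (chain_taylor (fun i => f (S i)) 3 y (/ 2) (fun i => Hf (S i)) Hy ltac:(lra))
    as [x1 [Hx1 E1]].
  destruct (chain_taylor (fun i => f (S (S i))) 2 y 1 (fun i => Hf (S (S i))) Hy ltac:(lra))
    as [x2 [Hx2 E2]].
  rewrite E0, E1, E2. simpl.
  generalize (HB x0 ltac:(lra)) (HB x1 ltac:(lra)) (HB x2 ltac:(lra)).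
  intros H0 H1 H2.
  (* The three Lagrange remainders contribute at most (1/120 + 1/384 + 1/144) B, well below B. *)
  apply Rabs_le_between in H0, H1, H2. apply Rabs_le_between. lra.
Qed.

(** * Powers u^(-(p+w)) as power series in w, with majorants *)

Definition pow_coef (p : R) (k : nat) (u : R) : R :=
  exp (- p * ln u) * ((- ln u) ^ k / INR (fact k)).

(* The d-th derivative in u of the coefficient of w^k in u^(-(p+w)). *)
Fixpoint dpow_coef (d : nat) (p : R) (k : nat) (u : R) : R :=
  match d with
  | O => pow_coef p k u
  | S d => - p * dpow_coef d (p + 1) k u
           - match k with O => 0 | S j => dpow_coef d (p + 1) j u end
  end.

(** The d-th derivative in u of u^(-(p+w)): each differentiation multiplies by -(p+w) and raises p
    by one. For p = 1 and w = z - 2, order 1 gives -(z-1) u^(-z). *)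
Fixpoint dpow (d : nat) (p w u : R) : R :=
  match d with
  | O => exp (- (p + w) * ln u)
  | S d => - (p + w) * dpow d (p + 1) w u
  end.

Lemma is_derive_dpow_coef (d : nat) (p : R) (k : nat) (u : R) : 0 < u ->
  is_derive (dpow_coef d p k) u (dpow_coef (S d) p k u).
Proof.
  intros Hu. revert p k. induction d as [|d IH]; intros p k.
  - change (is_derive (fun u => exp (- p * ln u) * ((- ln u) ^ k / INR (fact k))) u
      (dpow_coef 1 p k u)).
    assert (Hk : INR (fact k) <> 0) by apply INR_fact_neq_0.
    auto_derive; [repeat split; lra|].
    assert (He : exp (- (p + 1) * ln u) = exp (- p * ln u) / u).
    { replace (- (p + 1) * ln u) with (- p * ln u + - ln u) by ring.
      rewrite exp_plus, exp_Ropp, exp_ln by exact Hu. reflexivity. }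
    simpl. unfold pow_coef. rewrite He.
    destruct k as [|k].
    + simpl. field. lra.
    + simpl pred. rewrite fact_simpl, mult_INR.
      assert (INR (fact k) <> 0) by apply INR_fact_neq_0.
      assert (INR (S k) <> 0) by (apply not_0_INR; lia).
      simpl pow. field. repeat split; try assumption; lra.
  - apply (is_derive_minus (V := R_NormedModule)
      (fun u => - p * dpow_coef d (p + 1) k u)
      (fun u => match k with O => 0 | S j => dpow_coef d (p + 1) j u end) u
      (- p * dpow_coef (S d) (p + 1) k u)
      (match k with O => 0 | S j => dpow_coef (S d) (p + 1) j u end)).
    + apply (is_derive_scal (dpow_coef d (p + 1) k)). apply IH.
    + destruct k as [|k].
      * apply (is_derive_const (V := R_NormedModule)).
      * apply IH.
Qed.

Lemma is_pseries_dpow (d : nat) (p w u : R) :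
  is_pseries (fun k => dpow_coef d p k u) w (dpow d p w u).
Proof.
  revert p. induction d as [|d IH]; intros p.
  - simpl. replace (exp (- (p + w) * ln u))
      with (scal (exp (- p * ln u)) (exp (w * - ln u))).
    2:{ unfold scal; simpl. unfold mult; simpl. rewrite <- exp_plus. f_equal. ring. }
    apply is_pseries_R.
    apply is_series_ext with (fun k => scal (exp (- p * ln u))
       (scal (pow_n (w * - ln u) k) (/ INR (fact k)))).
    + intros k. unfold pow_coef, scal; simpl. unfold mult; simpl.
      rewrite pow_n_pow, Rpow_mult_distr. unfold Rdiv. ring.
    + apply (is_series_scal (V := R_NormedModule)). apply is_exp_Reals.
  - simpl dpow.
    replace (- (p + w) * dpow d (p + 1) w u)
      with (minus (scal (- p) (dpow d (p + 1) w u)) (scal w (dpow d (p + 1) w u))).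
    2:{ unfold minus, plus, opp, scal; simpl. unfold mult; simpl. ring. }
    apply (is_pseries_minus (V := R_NormedModule)
      (PS_scal (- p) (fun k => dpow_coef d (p + 1) k u))
      (PS_incr_1 (fun k => dpow_coef d (p + 1) k u))).
    + apply (is_pseries_scal (V := R_NormedModule)); [apply Rmult_comm | apply IH].
    + apply (is_pseries_incr_1 (V := R_NormedModule)). apply IH.
Qed.

(** Majorant of [dpow_coef] valid for all u >= y with |ln u| <= L: every sign becomes plus, u^(-p)
    becomes y^(-p), and |ln u| becomes L. *)
Fixpoint dpow_major (y L : R) (d : nat) (p : R) (k : nat) : R :=
  match d with
  | O => exp (- p * ln y) * (L ^ k / INR (fact k))
  | S d => p * dpow_major y L d (p + 1) k
           + match k with O => 0 | S j => dpow_major y L d (p + 1) j end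
  end.

Lemma dpow_major_ge_0 (y L : R) (d : nat) (p : R) (k : nat) :
  0 <= L -> 0 <= p -> 0 <= dpow_major y L d p k.
Proof.
  intros HL. revert p k. induction d as [|d IH]; intros p k Hp; simpl.
  - apply Rmult_le_pos; [left; apply exp_pos|].
    apply Rmult_le_pos; [now apply pow_le|].
    left. apply Rinv_0_lt_compat, INR_fact_lt_0.
  - apply Rplus_le_le_0_compat.
    + apply Rmult_le_pos; [exact Hp | apply IH; lra].
    + destruct k as [|k]; [lra | apply IH; lra].
Qed.

Lemma dpow_coef_major (y L u : R) (d : nat) (p : R) (k : nat) :
  0 < y <= u -> Rabs (ln u) <= L -> 0 <= p ->
  Rabs (dpow_coef d p k u) <= dpow_major y L d p k.
Proof.
  intros Hy HL. revert p k. induction d as [|d IH]; intros p k Hp; simpl.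
  - unfold pow_coef, Rdiv. rewrite !Rabs_mult, <- RPow_abs, Rabs_Ropp.
    rewrite (Rabs_pos_eq (exp _)) by (left; apply exp_pos).
    assert (Hi : 0 < / INR (fact k)) by apply Rinv_0_lt_compat, INR_fact_lt_0.
    rewrite (Rabs_pos_eq (/ _)) by lra.
    apply Rmult_le_compat.
    + left; apply exp_pos.
    + apply Rmult_le_pos; [apply pow_le, Rabs_pos | lra].
    + assert (Hln : ln y <= ln u) by (apply ln_le; lra).
      destruct (Req_dec (- p * ln u) (- p * ln y)) as [-> | Hne]; [lra|].
      left. apply exp_increasing. nra.
    + apply Rmult_le_compat_r; [lra|]. apply pow_incr. split; [apply Rabs_pos | exact HL].
  - unfold Rminus. eapply Rle_trans; [apply Rabs_triang|].
    rewrite Rabs_Ropp, Rabs_mult, Rabs_Ropp, (Rabs_pos_eq p) by exact Hp.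
    apply Rplus_le_compat.
    + apply Rmult_le_compat_l; [exact Hp | apply IH; lra].
    + destruct k as [|k]; [rewrite Rabs_R0; lra | apply IH; lra].
Qed.

(** Sum at w = 4 of the series with coefficients [dpow_major]; the factor p + w of a differentiation
    becomes p + 4. *)
Fixpoint dpow_major_sum (y L : R) (d : nat) (p : R) : R :=
  match d with
  | O => exp (- p * ln y) * exp (4 * L)
  | S d => (p + 4) * dpow_major_sum y L d (p + 1)
  end.

Lemma sum_n_le_series (a : nat -> R) (l : R) (N : nat) :
  (forall n, 0 <= a n) -> is_series a l -> sum_n a N <= l.
Proof.
  intros Ha Hl.
  apply (is_lim_seq_incr_compare (sum_n a) l Hl).
  intros n. rewrite sum_Sn. unfold plus; simpl. generalize (Ha (S n)). lra.
Qed.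

Lemma sum_n_dpow_major (y L : R) (d : nat) (p : R) (N : nat) :
  0 <= L -> 0 <= p ->
  sum_n (fun k => dpow_major y L d p k * 4 ^ k) N <= dpow_major_sum y L d p.
Proof.
  intros HL. revert p. induction d as [|d IH]; intros p Hp; simpl.
  - rewrite (sum_n_ext _ (fun k => scal (exp (- p * ln y))
       (scal (pow_n (4 * L) k) (/ INR (fact k))))).
    + rewrite sum_n_scal_l. unfold scal at 1; simpl. unfold mult; simpl.
      apply Rmult_le_compat_l; [left; apply exp_pos|].
      apply sum_n_le_series.
      * intros n. unfold scal; simpl. unfold mult; simpl. rewrite pow_n_pow.
        apply Rmult_le_pos; [apply pow_le; lra|].
        left. apply Rinv_0_lt_compat, INR_fact_lt_0.
      * apply is_exp_Reals.
    + intros k. unfold scal; simpl. unfold mult; simpl.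
      rewrite (pow_n_pow (4 * L) k), Rpow_mult_distr. unfold Rdiv. ring.
  - rewrite (sum_n_ext _ (fun k => plus (scal p (dpow_major y L d (p + 1) k * 4 ^ k))
       (match k with O => 0 | S j => dpow_major y L d (p + 1) j end * 4 ^ k))).
    + rewrite sum_n_plus, sum_n_scal_l. unfold plus, scal; simpl. unfold mult; simpl.
      rewrite Rmult_plus_distr_r.
      assert (IH' := IH (p + 1) ltac:(lra)).
      apply Rplus_le_compat.
      * now apply Rmult_le_compat_l.
      * eapply Rle_trans; [apply (sum_n_incr_le (dpow_major y L d (p + 1)) 4 N)|].
        -- lra.
        -- intros j. apply dpow_major_ge_0; lra.
        -- apply Rmult_le_compat_l; [lra | exact IH'].
    + intros k. unfold plus, scal; simpl. unfold mult; simpl. ring.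
Qed.

(** * Power series whose coefficients are series *)

Section Double_power_series.

Variables (c : nat -> nat -> R) (M : nat -> R).
Hypothesis c_bound : forall n N, sum_n (fun k => Rabs (c n k) * 4 ^ k) N <= M n.
Hypothesis M_series : ex_series M.

Let col (k : nat) : R := Series (fun n => c n k).

Lemma row_term_le (n k : nat) : Rabs (c n k) * 4 ^ k <= M n.
Proof.
  eapply Rle_trans; [|apply (c_bound n k)].
  apply (term_le_sum_n (fun k => Rabs (c n k) * 4 ^ k)).
  intros j. apply Rmult_le_pos; [apply Rabs_pos | apply pow_le; lra].
Qed.

Lemma abs_col_ex_series (k : nat) : ex_series (fun n => Rabs (c n k)).
Proof.
  apply (ex_series_le (V := R_CompleteNormedModule) _ M); [|exact M_series].
  intros n. change (Rabs (Rabs (c n k)) <= M n). rewrite Rabs_Rabsolu.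
  eapply Rle_trans; [|apply (row_term_le n k)].
  assert (1 <= 4 ^ k) by (apply pow_R1_Rle; lra).
  generalize (Rabs_pos (c n k)). nra.
Qed.

Lemma is_series_col (k : nat) : is_series (fun n => c n k) (col k).
Proof. apply Series_correct, ex_series_Rabs, abs_col_ex_series. Qed.

(** Absolute values, values and derivatives of the rows are all dominated entrywise by |c n k| 4^k,
    so this one exchange serves the three results on [col]. *)
Lemma is_series_exchange_dominated (u : nat -> nat -> R) (s v : nat -> R) :
  (forall n k, Rabs (u n k) <= Rabs (c n k) * 4 ^ k) ->
  (forall n, is_series (u n) (s n)) ->
  (forall k, is_series (fun n => u n k) (v k)) ->
  exists T, is_series s T /\ is_series v T.
Proof.
  intros Hu Hs Hv.
  assert (Hb : forall n N, sum_n (fun k => Rabs (u n k)) N <= M n).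
  { intros n N. eapply Rle_trans; [|apply (c_bound n N)].
    apply sum_n_m_le. intros k. apply Hu. }
  destruct (ex_series_le (V := R_CompleteNormedModule) s M) as [T HT]; [|exact M_series|].
  - intros n. apply (norm_lim_le (V := R_NormedModule) _ _ _ (Hs n)).
    exists 0%nat. intros N _.
    eapply Rle_trans; [apply (norm_sum_n (V := R_NormedModule)) | apply Hb].
  - exists T. split; [exact HT|].
    exact (is_series_exchange (V := R_NormedModule) u s v T M Hb M_series Hs Hv HT).
Qed.

Lemma ex_series_abs_col : ex_series (fun k => Rabs (col k) * 4 ^ k).
Proof.
  destruct (is_series_exchange_dominated (fun n k => Rabs (c n k) * 4 ^ k)
    (fun n => Series (fun k => Rabs (c n k) * 4 ^ k))
    (fun k => Series (fun n => Rabs (c n k)) * 4 ^ k)) as [T [_ HT]].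
  - intros n k. rewrite Rabs_pos_eq; [lra|].
    apply Rmult_le_pos; [apply Rabs_pos | apply pow_le; lra].
  - intros n. apply Series_correct. apply (ex_series_bounded _ (M n)).
    + intros k. apply Rmult_le_pos; [apply Rabs_pos | apply pow_le; lra].
    + apply c_bound.
  - intros k. apply is_series_scal_r. apply Series_correct, abs_col_ex_series.
  - apply (ex_series_le (V := R_CompleteNormedModule) _
      (fun k => Series (fun n => Rabs (c n k)) * 4 ^ k)).
    + intros k. change (Rabs (Rabs (col k) * 4 ^ k)
        <= Series (fun n => Rabs (c n k)) * 4 ^ k).
      assert (0 <= 4 ^ k) by (apply pow_le; lra).
      rewrite Rabs_pos_eq by (apply Rmult_le_pos; [apply Rabs_pos | assumption]).
      apply Rmult_le_compat_r; [assumption|].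
      apply Series_Rabs, abs_col_ex_series.
    + now exists T.
Qed.

Lemma is_series_PSeries_col (w : R) (s : nat -> R) : Rabs w <= 4 ->
  (forall n, is_pseries (c n) w (s n)) -> is_series s (PSeries col w).
Proof.
  intros Hw Hs.
  destruct (is_series_exchange_dominated (fun n k => c n k * w ^ k) s (fun k => col k * w ^ k))
    as [T [H1 H2]].
  - intros n k. rewrite Rabs_mult, <- RPow_abs.
    apply Rmult_le_compat_l; [apply Rabs_pos|].
    apply pow_incr. split; [apply Rabs_pos | exact Hw].
  - intros n. apply is_pseries_R, Hs.
  - intros k. apply is_series_scal_r, is_series_col.
  - replace (PSeries col w) with T; [exact H1|].
    symmetry. apply is_series_unique in H2. exact H2.
Qed.

(** The factor k + 1 created by differentiation at radius 3 is absorbed by the weight of radius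
    4. *)
Lemma succ_mul_pow_le (k : nat) : INR (S k) * 3 ^ k <= 4 ^ S k.
Proof.
  induction k as [|k IH]; [simpl; lra|].
  rewrite S_INR. simpl pow in *.
  assert (3 ^ k <= 4 ^ k) by (apply pow_incr; lra).
  assert (0 <= 3 ^ k) by (apply pow_le; lra). nra.
Qed.

Lemma is_series_PSeries_derive_col (w : R) (s : nat -> R) : Rabs w <= 3 ->
  (forall n, is_pseries (PS_derive (c n)) w (s n)) ->
  is_series s (PSeries (PS_derive col) w).
Proof.
  intros Hw Hs.
  assert (Hb : forall k, INR (S k) * Rabs w ^ k <= 4 ^ S k).
  { intros k. eapply Rle_trans; [|apply succ_mul_pow_le].
    apply Rmult_le_compat_l; [apply pos_INR|].
    apply pow_incr. split; [apply Rabs_pos | exact Hw]. }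
  (* Padding with a zero aligns the indices: the derivative term of index j involves c n (j+1) and
     has to be compared with the weight 4^(j+1). *)
  set (u := fun n k => match k with O => 0 | S j => PS_derive (c n) j * w ^ j end).
  set (v := fun k => match k with O => 0 | S j => PS_derive col j * w ^ j end).
  destruct (is_series_exchange_dominated u s v) as [T [H1 H2]].
  - intros n [|k]; simpl u.
    + rewrite Rabs_R0. apply Rmult_le_pos; [apply Rabs_pos | apply pow_le; lra].
    + unfold PS_derive. rewrite !Rabs_mult, <- RPow_abs, (Rabs_pos_eq (INR _)) by apply pos_INR.
      generalize (Rmult_le_compat_l _ _ _ (Rabs_pos (c n (S k))) (Hb k)). lra.
  - intros n. apply (is_series_decr_1 (V := R_NormedModule)).
    change (is_series (fun k => PS_derive (c n) k * w ^ k) (s n + - 0)).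
    rewrite Ropp_0, Rplus_0_r. apply is_pseries_R, Hs.
  - intros [|k]; simpl.
    + assert (H := is_series_scal (V := R_NormedModule) 0 _ _ (is_series_col 0%nat)).
      change (is_series (fun n => 0 * c n 0%nat) (0 * col 0%nat)) in H.
      rewrite Rmult_0_l in H.
      apply is_series_ext with (2 := H). intros n. apply Rmult_0_l.
    + unfold u, PS_derive. apply is_series_scal_r.
      apply (is_series_scal (V := R_NormedModule)), is_series_col.
  - replace (PSeries (PS_derive col) w) with T; [exact H1|].
    symmetry. apply is_series_unique.
    apply (is_series_incr_1 (V := R_NormedModule) v).
    change (is_series v (T + 0)). rewrite Rplus_0_r. exact H2.
Qed.

End Double_power_series.

(** * Corrected midpoint sums and their increments *)

Fixpoint bsum (f : nat -> R) (N : nat) : R :=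
  match N with O => 0 | S N => bsum f N + f N end.

Lemma sum_n_S_R (f : nat -> R) (N : nat) : sum_n f (S N) = sum_n f N + f (S N) :> R.
Proof. exact (sum_Sn (G := R_AbelianMonoid) f N). Qed.

Lemma sum_n_bsum (f : nat -> R) (N : nat) : sum_n f N = bsum f (S N) :> R.
Proof.
  induction N as [|N IH].
  - rewrite sum_O. simpl. ring.
  - rewrite sum_n_S_R, IH. reflexivity.
Qed.

(** [phi d] is the d-th derivative of one function. By the midpoint rule its increment over a unit
    interval is phi' at the midpoint plus 1/24 of the increment of phi'', up to fifth order, so this
    quantity converges once the fifth derivative is summable. *)
Definition euler_maclaurin_sum (a : R) (phi : nat -> R -> R) (N : nat) : R :=
  - bsum (fun n => phi 1%nat (a + INR n + / 2)) N
  + phi 0%nat (a + INR N) - phi 2%nat (a + INR N) / 24.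

(** Increments of the corrected sums, with the value at N = 0 kept as term 0. Hence term S n belongs
    to the interval from a + n to a + n + 1, and summing up to N uses N midpoints. *)
Definition euler_maclaurin_term (a : R) (phi : nat -> R -> R) (n : nat) : R :=
  match n with
  | O => phi 0%nat a - phi 2%nat a / 24
  | S n => - phi 1%nat (a + INR n + / 2)
           + (phi 0%nat (a + INR n + 1) - phi 0%nat (a + INR n))
           - (phi 2%nat (a + INR n + 1) - phi 2%nat (a + INR n)) / 24
  end.

Lemma sum_n_euler_maclaurin (a : R) (phi : nat -> R -> R) (N : nat) :
  sum_n (euler_maclaurin_term a phi) N = euler_maclaurin_sum a phi N :> R.
Proof.
  unfold euler_maclaurin_sum. induction N as [|N IH].
  - rewrite sum_O. simpl. rewrite Rplus_0_r. ring.
  - rewrite sum_n_S_R, IH. simpl bsum. simpl euler_maclaurin_term.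
    rewrite S_INR. replace (a + (INR N + 1)) with (a + INR N + 1) by ring.
    unfold Rdiv. simpl. ring.
Qed.

Lemma sum_n_euler_maclaurin_term (a : R) (psi : nat -> nat -> R -> R) (n N : nat) :
  sum_n (fun k => euler_maclaurin_term a (fun d => psi d k) n) N
  = euler_maclaurin_term a (fun d u => sum_n (fun k => psi d k u) N) n :> R.
Proof.
  induction N as [|N IH].
  - rewrite sum_O. destruct n; simpl; now rewrite !sum_O.
  - rewrite sum_n_S_R, IH. destruct n; simpl; rewrite !sum_n_S_R; field.
Qed.

(** For fixed n the term is a finite linear combination of values of phi, so it commutes with the
    limit in k. *)
Lemma is_series_euler_maclaurin_term (a : R) (psi : nat -> nat -> R -> R)
    (phi : nat -> R -> R) (n : nat) :
  (forall d u, is_series (fun k => psi d k u) (phi d u)) ->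
  is_series (fun k => euler_maclaurin_term a (fun d => psi d k) n)
    (euler_maclaurin_term a phi n).
Proof.
  intros H.
  assert (Hl : forall d u, is_lim_seq (sum_n (fun k => psi d k u)) (phi d u)) by exact H.
  change (is_lim_seq (sum_n (fun k => euler_maclaurin_term a (fun d => psi d k) n))
    (euler_maclaurin_term a phi n)).
  apply is_lim_seq_ext with
    (fun N => euler_maclaurin_term a (fun d u => sum_n (fun k => psi d k u) N) n).
  - intros N. symmetry. apply sum_n_euler_maclaurin_term.
  - destruct n as [|n]; simpl; unfold Rdiv.
    + apply is_lim_seq_minus'; [apply Hl|].
      apply is_lim_seq_mult'; [apply Hl | apply is_lim_seq_const].
    + apply is_lim_seq_minus'.
      * apply is_lim_seq_plus'.
        -- apply (is_lim_seq_opp _ (phi 1%nat _)), Hl.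
        -- apply is_lim_seq_minus'; apply Hl.
      * apply is_lim_seq_mult'; [|apply is_lim_seq_const].
        apply is_lim_seq_minus'; apply Hl.
Qed.

(** * Summability of the weighted coefficients *)

Lemma exp_INR_mul_ln (n : nat) (y : R) : 0 < y -> exp (INR n * ln y) = y ^ n.
Proof. intros Hy. exact (Rpower_pow n y Hy). Qed.

(** Comparison with the telescoping differences 1/y - 1/(y+1) >= 1/(y+1)^2. *)
Lemma ex_series_inv_sqr (a : R) : 0 < a -> ex_series (fun n => / (a + INR n) ^ 2).
Proof.
  intros Ha.
  assert (Hp : forall n, 0 < a + INR n) by (intros n; generalize (pos_INR n); lra).
  apply (ex_series_bounded _ (/ a ^ 2 + / a)).
  - intros n. left. apply Rinv_0_lt_compat, pow_lt, Hp.
  - intros N. apply Rle_trans with (/ a ^ 2 + / a - / (a + INR N)).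
    + induction N as [|N IH].
      * rewrite sum_O. simpl INR. rewrite Rplus_0_r. lra.
      * rewrite sum_n_S_R.
        apply Rle_trans with (/ a ^ 2 + / a - / (a + INR N) + / (a + INR (S N)) ^ 2);
          [apply Rplus_le_compat_r; exact IH|].
        cut (/ (a + INR (S N)) ^ 2 <= / (a + INR N) - / (a + INR (S N))); [lra|].
        rewrite S_INR. generalize (Hp N). set (y := a + INR N). intros Hy.
        replace (a + (INR N + 1)) with (y + 1) by (unfold y; ring).
        replace (/ y - / (y + 1)) with (/ (y * (y + 1))) by (field; lra).
        apply Rinv_le_contravar; [nra | nra].
    + generalize (Rinv_0_lt_compat _ (Hp N)). lra.
Qed.

(** Coefficient of w^k in the n-th increment for u^(-(1+w)); w = z - 2 puts the centre of expansion
    at 2. *)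
Definition zeta_coef (a : R) (n k : nat) : R :=
  euler_maclaurin_term a (fun d => dpow_coef d 1 k) n.

Definition log_bound (y : R) : R := Rmax (ln (y + 1)) (- ln y).

(** Term 0 is not an increment and is bounded piece by piece; every later term is bounded by the
    fifth derivative on its interval. *)
Definition zeta_coef_bound (a : R) (n : nat) : R :=
  match n with
  | O => dpow_major_sum a (Rabs (ln a)) 0 1 + dpow_major_sum a (Rabs (ln a)) 2 1
  | S n => dpow_major_sum (a + INR n) (log_bound (a + INR n)) 5 1
  end.

Lemma log_bound_correct (y u : R) : 0 < y -> y <= u <= y + 1 -> Rabs (ln u) <= log_bound y.
Proof.
  intros Hy Hu. unfold log_bound.
  assert (ln y <= ln u) by (apply ln_le; lra).
  assert (ln u <= ln (y + 1)) by (apply ln_le; lra).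
  generalize (Rmax_l (ln (y + 1)) (- ln y)) (Rmax_r (ln (y + 1)) (- ln y)).
  intros. apply Rabs_le. lra.
Qed.

Lemma zeta_coef_sum_le (a : R) (n N : nat) : 0 < a ->
  sum_n (fun k => Rabs (zeta_coef a n k) * 4 ^ k) N <= zeta_coef_bound a n.
Proof.
  intros Ha.
  assert (H4 : forall k, 0 <= 4 ^ k) by (intros k; apply pow_le; lra).
  destruct n as [|n]; simpl.
  - set (L := Rabs (ln a)). assert (HL : 0 <= L) by apply Rabs_pos.
    apply Rle_trans with
      (sum_n (fun k => plus (dpow_major a L 0 1 k * 4 ^ k) (dpow_major a L 2 1 k * 4 ^ k)) N).
    + apply sum_n_m_le. intros k. unfold plus; simpl plus.
      change (Rabs (zeta_coef a 0 k) * 4 ^ k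
        <= dpow_major a L 0 1 k * 4 ^ k + dpow_major a L 2 1 k * 4 ^ k).
      rewrite <- Rmult_plus_distr_r. apply Rmult_le_compat_r; [apply H4|].
      unfold zeta_coef, euler_maclaurin_term, Rminus.
      eapply Rle_trans; [apply Rabs_triang|]. rewrite Rabs_Ropp.
      assert (Hm : forall d, Rabs (dpow_coef d 1 k a) <= dpow_major a L d 1 k).
      { intros d. apply dpow_coef_major; [lra | unfold L; lra | lra]. }
      apply Rplus_le_compat; [apply Hm|].
      unfold Rdiv. rewrite Rabs_mult, (Rabs_pos_eq (/ 24)) by lra.
      generalize (Hm 2%nat) (Rabs_pos (dpow_coef 2 1 k a)). lra.
    + rewrite sum_n_plus. apply Rplus_le_compat; apply sum_n_dpow_major; lra.
  - assert (Hy : 0 < a + INR n) by (generalize (pos_INR n); lra).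
    set (y := a + INR n) in *.
    assert (HL : 0 <= log_bound y).
    { eapply Rle_trans; [apply Rabs_pos | apply (log_bound_correct y y Hy)]. lra. }
    eapply Rle_trans; [|apply (sum_n_dpow_major y (log_bound y) 5 1 N); [exact HL | lra]].
    apply sum_n_m_le. intros k. apply Rmult_le_compat_r; [apply H4|].
    unfold zeta_coef, euler_maclaurin_term. fold y.
    apply (midpoint_euler_maclaurin_bound (fun d => dpow_coef d 1 k)).
    + intros i u Hu. now apply is_derive_dpow_coef.
    + exact Hy.
    + intros u Hu. apply dpow_coef_major; [lra | now apply log_bound_correct | lra].
Qed.

(** Five differentiations starting from p = 1 leave y^(-6), while exp(4 L) <= (y+1)^4 + y^(-4). The
    product is y^(-2) times (1 + 1/y)^4 + y^(-8), which is bounded because y >= a. *)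
Lemma ex_series_zeta_coef_bound (a : R) : 0 < a -> ex_series (zeta_coef_bound a).
Proof.
  intros Ha. apply (ex_series_incr_1 (V := R_NormedModule)).
  (* 15120 = 5 · 6 · 7 · 8 · 9, the product of the factors p + 4 for p = 1, ..., 5. *)
  set (K := 15120 * ((1 + / a) ^ 4 + (/ a) ^ 8)).
  apply (ex_series_le (V := R_CompleteNormedModule) _
    (fun n => scal K (/ (a + INR n) ^ 2))).
  2:{ apply (ex_series_scal (V := R_NormedModule)), ex_series_inv_sqr, Ha. }
  intros n.
  assert (Hya : a <= a + INR n) by (generalize (pos_INR n); lra).
  change (Rabs (dpow_major_sum (a + INR n) (log_bound (a + INR n)) 5 1)
            <= K * / (a + INR n) ^ 2).
  set (y := a + INR n) in *. assert (Hy : 0 < y) by lra.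
  assert (E6 : exp (- (1 + 1 + 1 + 1 + 1 + 1) * ln y) = (/ y) ^ 6).
  { replace (- (1 + 1 + 1 + 1 + 1 + 1) * ln y) with (- (INR 6 * ln y)) by (simpl; ring).
    rewrite exp_Ropp, exp_INR_mul_ln, pow_inv by exact Hy. reflexivity. }
  assert (E4 : exp (4 * log_bound y) <= (y + 1) ^ 4 + (/ y) ^ 4).
  { assert (E1 : exp (4 * ln (y + 1)) = (y + 1) ^ 4).
    { replace (4 * ln (y + 1)) with (INR 4 * ln (y + 1)) by (simpl; ring).
      apply exp_INR_mul_ln. lra. }
    assert (E2 : exp (4 * - ln y) = (/ y) ^ 4).
    { replace (4 * - ln y) with (- (INR 4 * ln y)) by (simpl; ring).
      rewrite exp_Ropp, exp_INR_mul_ln, pow_inv by exact Hy. reflexivity. }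
    rewrite <- E1, <- E2. unfold log_bound.
    generalize (exp_pos (4 * ln (y + 1))) (exp_pos (4 * - ln y)).
    apply Rmax_case; lra. }
  assert (Hi : 0 < / y) by now apply Rinv_0_lt_compat.
  assert (Hi2 : / y <= / a) by (apply Rinv_le_contravar; lra).
  simpl dpow_major_sum. rewrite E6.
  rewrite Rabs_pos_eq.
  2:{ repeat (apply Rmult_le_pos; [first [lra | apply pow_le; lra]|]).
      left; apply exp_pos. }
  replace ((1 + 4) * ((1 + 1 + 4) * ((1 + 1 + 1 + 4) * ((1 + 1 + 1 + 1 + 4) *
      ((1 + 1 + 1 + 1 + 1 + 4) * ((/ y) ^ 6 * exp (4 * log_bound y)))))))
    with (15120 * ((/ y) ^ 6 * exp (4 * log_bound y))) by ring.
  unfold K. rewrite Rmult_assoc. apply Rmult_le_compat_l; [lra|].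
  apply Rle_trans with ((/ y) ^ 6 * ((y + 1) ^ 4 + (/ y) ^ 4)).
  - apply Rmult_le_compat_l; [apply pow_le; lra | exact E4].
  - replace ((/ y) ^ 6 * ((y + 1) ^ 4 + (/ y) ^ 4))
      with (((1 + / y) ^ 4 + (/ y) ^ 8) * / y ^ 2) by (field; lra).
    apply Rmult_le_compat_r; [left; apply Rinv_0_lt_compat, pow_lt, Hy|].
    apply Rplus_le_compat; apply pow_incr; lra.
Qed.

(** * The derivative of the Hurwitz zeta function at -1 *)

Lemma bsum_ext (f g : nat -> R) (N : nat) :
  (forall n, f n = g n) -> bsum f N = bsum g N.
Proof. intros H. induction N as [|N IH]; simpl; [reflexivity | now rewrite IH, H]. Qed.

Lemma bsum_linear (f g : nat -> R) (x y : R) (N : nat) :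
  bsum (fun n => x * f n + y * g n) N = x * bsum f N + y * bsum g N.
Proof. induction N as [|N IH]; simpl; [ring | rewrite IH; ring]. Qed.

Lemma is_lim_seq_exp_neg_ln (a c : R) : 0 < a -> 0 < c ->
  is_lim_seq (fun N => exp (- c * ln (a + INR N))) 0.
Proof.
  intros Ha Hc.
  apply (is_lim_comp_seq exp _ m_infty 0 is_lim_exp_m).
  - exists 0%nat. intros n _. discriminate.
  - apply is_lim_seq_spec. intros B.
    destruct (INR_unbounded (exp (- B / c))) as [N HN].
    exists N. intros n Hn.
    assert (HNn : INR N <= INR n) by now apply le_INR.
    assert (Hl : - B / c < ln (a + INR n)).
    { rewrite <- (ln_exp (- B / c)). apply ln_increasing; [apply exp_pos | lra]. }
    apply (Rmult_lt_compat_l c) in Hl; [|exact Hc].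
    replace (c * (- B / c)) with (- B) in Hl by (field; lra). lra.
Qed.

Section Zeta_series.

Variable a : R.
Hypothesis a_pos : 0 < a.

Let coef (k : nat) : R := Series (fun n => zeta_coef a n k).

Lemma shift_pos (n : nat) : 0 < a + INR n.
Proof. generalize (pos_INR n). lra. Qed.

Lemma is_pseries_zeta_coef (n : nat) (w : R) :
  is_pseries (zeta_coef a n) w (euler_maclaurin_term a (fun d => dpow d 1 w) n).
Proof.
  apply is_pseries_R.
  apply is_series_ext with
    (fun k => euler_maclaurin_term a (fun d u => dpow_coef d 1 k u * w ^ k) n).
  - intros k. unfold zeta_coef. destruct n; simpl; field.
  - apply (is_series_euler_maclaurin_term a (fun d k u => dpow_coef d 1 k u * w ^ k)).
    intros d u. apply is_pseries_R, is_pseries_dpow.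
Qed.

Lemma zeta_series_lim (w : R) : Rabs w <= 4 ->
  is_lim_seq (euler_maclaurin_sum a (fun d => dpow d 1 w)) (PSeries coef w).
Proof.
  intros Hw.
  apply is_lim_seq_ext with (sum_n (euler_maclaurin_term a (fun d => dpow d 1 w))).
  - intros N. apply sum_n_euler_maclaurin.
  - apply (is_series_PSeries_col (zeta_coef a) (zeta_coef_bound a)).
    + intros n N. now apply zeta_coef_sum_le.
    + now apply ex_series_zeta_coef_bound.
    + exact Hw.
    + intros n. apply is_pseries_zeta_coef.
Qed.

(* The derivative in w of [dpow d 1 w u] at w = -3. *)
Definition dpow_deriv (d : nat) (u : R) : R :=
  match d with
  | O => - ln u * u ^ 2
  | S O => - u - 2 * u * ln u
  | _ => -3 - 2 * ln u
  end.

(** The restriction on d matters: the last branch of [dpow_deriv] is the right formula at d = 2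
    only, the highest order occurring in the corrected sums. *)
Lemma is_derive_dpow (d : nat) (u : R) : (d <= 2)%nat -> 0 < u ->
  is_derive (fun w => dpow d 1 w u) (-3) (dpow_deriv d u).
Proof.
  intros Hd Hu.
  assert (E2 : exp (2 * ln u) = u ^ 2).
  { replace 2 with (INR 2) by (simpl; ring). now apply exp_INR_mul_ln. }
  destruct d as [|[|[|d]]]; [| | |lia]; simpl; auto_derive; trivial.
  - replace (- (1 + -3) * ln u) with (2 * ln u) by ring. rewrite E2. ring.
  - replace (- (1 + 1 + -3) * ln u) with (ln u) by ring.
    rewrite exp_ln by exact Hu. ring.
  - replace (- (1 + 1 + 1 + -3) * ln u) with 0 by ring. rewrite exp_0. ring.
Qed.

Lemma is_derive_euler_maclaurin_term (phi : R -> nat -> R -> R) (dphi : nat -> R -> R)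
    (w : R) (n : nat) :
  (forall d u, (d <= 2)%nat -> 0 < u -> is_derive (fun w => phi w d u) w (dphi d u)) ->
  is_derive (fun w => euler_maclaurin_term a (phi w) n) w (euler_maclaurin_term a dphi n).
Proof.
  intros H. destruct n as [|n]; simpl.
  - apply (is_derive_minus (V := R_NormedModule)); [apply H; auto; lra|].
    apply (is_derive_scal_l (V := R_NormedModule) (fun w => phi w 2%nat a)).
    apply H; auto.
  - generalize (shift_pos n). intros Hy.
    apply (is_derive_minus (V := R_NormedModule)).
    + apply (is_derive_plus (V := R_NormedModule)).
      * apply (is_derive_opp (V := R_NormedModule)). apply H; [lia | lra].
      * apply (is_derive_minus (V := R_NormedModule)); apply H; lia || lra.
    + apply (is_derive_scal_l (V := R_NormedModule)
        (fun w => phi w 2%nat (a + INR n + 1) - phi w 2%nat (a + INR n))).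
      apply (is_derive_minus (V := R_NormedModule)); apply H; lia || lra.
Qed.

(** Each row has radius of convergence at least 4, so its derived series at -3 sums to the
    derivative of its closed form, which [dpow_deriv] makes explicit. *)
Lemma zeta_series_deriv_lim :
  is_lim_seq (euler_maclaurin_sum a dpow_deriv) (PSeries (PS_derive coef) (-3)).
Proof.
  apply is_lim_seq_ext with (sum_n (euler_maclaurin_term a dpow_deriv)).
  - intros N. apply sum_n_euler_maclaurin.
  - apply (is_series_PSeries_derive_col (zeta_coef a) (zeta_coef_bound a)).
    + intros n N. now apply zeta_coef_sum_le.
    + now apply ex_series_zeta_coef_bound.
    + apply Rabs_le; lra.
    + intros n.
      replace (euler_maclaurin_term a dpow_deriv n)
        with (Derive (PSeries (zeta_coef a n)) (-3)).
      * apply is_pseries_derive. apply Rbar_lt_le_trans with 4.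
        -- change (Rabs (-3) < 4). apply Rabs_def1; lra.
        -- apply (proj1 (CV_radius_bounded (zeta_coef a n))).
           exists (zeta_coef_bound a n). intros k.
           rewrite Rabs_mult, (Rabs_pos_eq (4 ^ k)) by (apply pow_le; lra).
           apply (row_term_le (zeta_coef a) (zeta_coef_bound a)).
           intros n' N. now apply zeta_coef_sum_le.
      * rewrite (Derive_ext _ (fun w => euler_maclaurin_term a (fun d => dpow d 1 w) n)).
        -- apply is_derive_unique.
           apply (is_derive_euler_maclaurin_term (fun w d => dpow d 1 w)).
           intros d u. apply is_derive_dpow.
        -- intros w. apply is_pseries_unique, is_pseries_zeta_coef.
Qed.

(** For x > 1 the endpoint corrections, of orders u^(1-x) and u^(-1-x), tend to 0. What remains are
    the midpoint terms, and the midpoints a + n + 1/2 are n + nu. *)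
Lemma is_series_zeta_coef (x : R) : 1 < x < 3 ->
  is_series (fun n => (x - 1) * exp (- x * ln (INR n + (a + / 2)))) (PSeries coef (x - 2)).
Proof.
  intros Hx.
  assert (Hl := zeta_series_lim (x - 2) ltac:(apply Rabs_le; lra)).
  (* Index shift: [sum_n] up to N has N + 1 terms, [bsum] up to N has only N. *)
  apply is_lim_seq_incr_1 in Hl.
  assert (Ht0 := is_lim_seq_exp_neg_ln a (1 + (x - 2)) a_pos ltac:(lra)).
  assert (Ht2 := is_lim_seq_exp_neg_ln a (1 + 1 + 1 + (x - 2)) a_pos ltac:(lra)).
  apply is_lim_seq_incr_1 in Ht0, Ht2.
  (* K is x (x-1) / 24, the factor of u^(-(x+1)) in the second-derivative correction. *)
  set (K := - (1 + (x - 2)) * - (1 + 1 + (x - 2)) / 24).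
  change (is_lim_seq (sum_n (fun n => (x - 1) * exp (- x * ln (INR n + (a + / 2)))))
    (PSeries coef (x - 2))).
  replace (PSeries coef (x - 2)) with (PSeries coef (x - 2) - 0 + K * 0) by ring.
  eapply is_lim_seq_ext;
    [|apply (is_lim_seq_plus' _ _ _ _ (is_lim_seq_minus' _ _ _ _ Hl Ht0)
        (is_lim_seq_mult' _ _ _ _ (is_lim_seq_const K) Ht2))].
  intros N. rewrite sum_n_bsum. unfold euler_maclaurin_sum.
  rewrite (bsum_ext (fun n => (x - 1) * exp (- x * ln (INR n + (a + / 2))))
    (fun n => -1 * dpow 1 1 (x - 2) (a + INR n + / 2) + 0 * 0)).
  - rewrite bsum_linear. cbn [dpow]. unfold K. field.
  - intros n. cbn [dpow].
    replace (INR n + (a + / 2)) with (a + INR n + / 2) by ring.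
    replace (- (1 + 1 + (x - 2))) with (- x) by ring. ring.
Qed.

(** For g(u) = u ln u this is a primitive of g minus g'(u)/24, the endpoint part of the midpoint
    formula. *)
Definition midpoint_primitive (u : R) : R :=
  u ^ 2 * ln u / 2 - u ^ 2 / 4 - 1 / 24 - ln u / 24.

Lemma hurwitz_derive_lim (zeta : C -> R -> C) : is_Hurwitz_zeta zeta ->
  exists Z : R,
    C_derive (fun z => zeta z (a + / 2)) (RtoC (-1)) = RtoC Z /\
    is_lim_seq (fun N => midpoint_primitive (a + INR N)
      - bsum (fun n => (a + INR n + / 2) * ln (a + INR n + / 2)) N) Z.
Proof.
  intros Hz.
  exists (- PSeries (PS_derive coef) (-3) / 2 - PSeries coef (-3) / 4). split.
  - apply (hurwitz_derive_minus_one zeta (a + / 2) coef Hz); [lra| |].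
    + apply (ex_series_abs_col (zeta_coef a) (zeta_coef_bound a)).
      * intros n N. now apply zeta_coef_sum_le.
      * now apply ex_series_zeta_coef_bound.
    + apply is_series_zeta_coef.
  - assert (H1 := zeta_series_deriv_lim).
    assert (H2 := zeta_series_lim (-3) ltac:(apply Rabs_le; lra)).
    replace (- PSeries (PS_derive coef) (-3) / 2 - PSeries coef (-3) / 4)
      with (- / 2 * PSeries (PS_derive coef) (-3) + - / 4 * PSeries coef (-3)) by field.
    eapply is_lim_seq_ext;
      [|apply (is_lim_seq_plus' _ _ _ _
          (is_lim_seq_mult' _ _ _ _ (is_lim_seq_const (- / 2)) H1)
          (is_lim_seq_mult' _ _ _ _ (is_lim_seq_const (- / 4)) H2))].
    intros N. unfold euler_maclaurin_sum.
    (* At w = -3 the midpoint terms are 2u for the value and -u - 2u ln u for the derivative; the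
       weights -1/4 and -1/2 combine them into u ln u. *)
    assert (E : bsum (fun n => (a + INR n + / 2) * ln (a + INR n + / 2)) N
      = - / 2 * bsum (fun n => dpow_deriv 1 (a + INR n + / 2)) N
        + - / 4 * bsum (fun n => dpow 1 1 (-3) (a + INR n + / 2)) N).
    { rewrite <- bsum_linear. apply bsum_ext. intros n. simpl.
      set (u := a + INR n + / 2).
      assert (Hu : 0 < u) by (generalize (shift_pos n); unfold u; lra).
      replace (- (1 + 1 + -3) * ln u) with (ln u) by ring.
      rewrite exp_ln by exact Hu. field. }
    rewrite E. generalize (shift_pos N). set (u := a + INR N). intros Hu.
    unfold midpoint_primitive. cbn [dpow]. cbn [dpow_deriv].
    replace (- (1 + -3) * ln u) with (INR 2 * ln u) by (simpl; ring).
    rewrite exp_INR_mul_ln by exact Hu.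
    replace (- (1 + 1 + 1 + -3) * ln u) with 0 by ring. rewrite exp_0.
    cbn [dpow_deriv]. field.
Qed.

End Zeta_series.

(** * Improper integrals and hyperbolic bounds *)

Lemma nondecreasing_of_derive (g g' : R -> R) (A u v : R) :
  (forall t, A < t -> is_derive g t (g' t)) -> (forall t, A < t -> 0 <= g' t) ->
  A < u <= v -> g u <= g v.
Proof.
  intros Hd Hp Huv. destruct (Req_dec u v) as [-> | Hne]; [lra|].
  destruct (MVT_gen g u v g') as [c [Hc E]].
  - intros t Ht. rewrite Rmin_left in Ht by lra. apply Hd. lra.
  - intros t Ht. rewrite Rmin_left in Ht by lra.
    apply continuity_pt_filterlim, (ex_derive_continuous (V := R_NormedModule)).
    eexists. apply Hd. lra.
  - rewrite Rmin_left in Hc by lra.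
    assert (0 <= g' c * (v - u)) by (apply Rmult_le_pos; [apply Hp|]; lra). lra.
Qed.

(** Both G - g and G + g are nondecreasing. Besides direct estimates, this lets g inherit the Cauchy
    property from G at the ends of the half-line. *)
Lemma derive_comparison (g g' G G' : R -> R) (A u v : R) :
  (forall t, A < t -> is_derive g t (g' t)) -> (forall t, A < t -> is_derive G t (G' t)) ->
  (forall t, A < t -> Rabs (g' t) <= G' t) -> A < u -> A < v ->
  Rabs (g u - g v) <= Rabs (G u - G v).
Proof.
  intros Hg HG Hle.
  assert (H : forall x y, A < x <= y -> Rabs (g x - g y) <= Rabs (G x - G y)).
  { intros x y Hxy.
    assert (H1 : G x - g x <= G y - g y).
    { apply (nondecreasing_of_derive (fun t => G t - g t) (fun t => G' t - g' t) A); [| |exact Hxy].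
      - intros t Ht. apply (is_derive_minus (V := R_NormedModule)); auto.
      - intros t Ht. generalize (Hle t Ht) (Rle_abs (g' t)). lra. }
    assert (H2 : G x + g x <= G y + g y).
    { apply (nondecreasing_of_derive (fun t => G t + g t) (fun t => G' t + g' t) A); [| |exact Hxy].
      - intros t Ht. apply (is_derive_plus (V := R_NormedModule)); auto.
      - intros t Ht. generalize (Hle t Ht) (Rle_abs (- g' t)). rewrite Rabs_Ropp. lra. }
    rewrite (Rabs_minus_sym (G x)), (Rabs_pos_eq (G y - G x)) by lra.
    apply Rabs_le. lra. }
  intros Hu Hv. destruct (Rle_dec u v) as [Huv|Huv].
  - apply H. lra.
  - rewrite (Rabs_minus_sym (g u)), (Rabs_minus_sym (G u)). apply H. lra.
Qed.

(** The rung of a ladder: each inequality for sinh, cosh and exp below has as derivative an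
    inequality already proved, and vanishes at 0. *)
Lemma nonneg_of_derive (g g' : R -> R) (u : R) :
  (forall t, is_derive g t (g' t)) -> (forall t, 0 <= t -> 0 <= g' t) ->
  g 0 = 0 -> 0 <= u -> 0 <= g u.
Proof.
  intros Hd Hp H0 Hu. destruct (MVT_gen g 0 u g') as [c [Hc E]].
  - intros; apply Hd.
  - intros t _. apply continuity_pt_filterlim, (ex_derive_continuous (V := R_NormedModule)).
    eexists. apply Hd.
  - rewrite Rmin_left in Hc by lra.
    assert (0 <= g' c * (u - 0)) by (apply Rmult_le_pos; [apply Hp|]; lra). lra.
Qed.

Lemma is_derive_sinh (t : R) : is_derive sinh t (cosh t).
Proof. apply is_derive_Reals, derivable_pt_lim_sinh. Qed.

Lemma is_derive_cosh (t : R) : is_derive cosh t (sinh t).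
Proof. apply is_derive_Reals, derivable_pt_lim_cosh. Qed.

Ltac hyperbolic_derive :=
  intros t; auto_derive;
  [ repeat split; (eexists; first [apply is_derive_sinh | apply is_derive_cosh])
  | rewrite ?(is_derive_unique (fun x => sinh x) t _ (is_derive_sinh t)),
      ?(is_derive_unique (fun x => cosh x) t _ (is_derive_cosh t)) ].

Lemma sinh_ge_0 (u : R) : 0 <= u -> 0 <= sinh u.
Proof.
  intros Hu. apply (nonneg_of_derive sinh cosh); [apply is_derive_sinh | | apply sinh_0 | exact Hu].
  intros t _. unfold cosh. generalize (exp_pos t) (exp_pos (- t)). lra.
Qed.

Lemma cosh_ge_1 (u : R) : 0 <= u -> 0 <= cosh u - 1.
Proof.
  apply (nonneg_of_derive (fun t => cosh t - 1) sinh).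
  - hyperbolic_derive. ring.
  - apply sinh_ge_0.
  - rewrite cosh_0. ring.
Qed.

Lemma sinh_ge_id (u : R) : 0 <= u -> 0 <= sinh u - u.
Proof.
  apply (nonneg_of_derive (fun t => sinh t - t) (fun t => cosh t - 1)).
  - hyperbolic_derive. ring.
  - apply cosh_ge_1.
  - rewrite sinh_0. ring.
Qed.

Lemma cosh_ge_quadratic (u : R) : 0 <= u -> 0 <= cosh u - 1 - u ^ 2 / 2.
Proof.
  apply (nonneg_of_derive (fun t => cosh t - 1 - t ^ 2 / 2) (fun t => sinh t - t)).
  - hyperbolic_derive. field.
  - apply sinh_ge_id.
  - rewrite cosh_0. field.
Qed.

Lemma sinh_ge_cubic (u : R) : 0 <= u -> 0 <= sinh u - u - u ^ 3 / 6.
Proof.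
  apply (nonneg_of_derive (fun t => sinh t - t - t ^ 3 / 6) (fun t => cosh t - 1 - t ^ 2 / 2)).
  - hyperbolic_derive. field.
  - apply cosh_ge_quadratic.
  - rewrite sinh_0. field.
Qed.

Lemma tanh_le_id (u : R) : 0 <= u -> 0 <= u * cosh u - sinh u.
Proof.
  apply (nonneg_of_derive (fun t => t * cosh t - sinh t) (fun t => t * sinh t)).
  - hyperbolic_derive. ring.
  - intros t Ht. apply Rmult_le_pos; [exact Ht | now apply sinh_ge_0].
  - rewrite cosh_0, sinh_0. ring.
Qed.

(** This is sinh u (1 - u^2/6) <= u, the lower bound for u csch u. Two differentiations reduce it to
    [tanh_le_id]. *)
Lemma sinh_mul_le (u : R) : 0 <= u -> 0 <= u - sinh u + u ^ 2 * sinh u / 6.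
Proof.
  apply (nonneg_of_derive (fun t => t - sinh t + t ^ 2 * sinh t / 6)
    (fun t => 1 - cosh t + t ^ 2 * cosh t / 6 + t * sinh t / 3)).
  - hyperbolic_derive. field.
  - intros v.
    apply (nonneg_of_derive (fun t => 1 - cosh t + t ^ 2 * cosh t / 6 + t * sinh t / 3)
      (fun t => 2 / 3 * (t * cosh t - sinh t) + t ^ 2 * sinh t / 6)).
    + hyperbolic_derive. field.
    + intros t Ht. generalize (tanh_le_id t Ht) (sinh_ge_0 t Ht) (pow2_ge_0 t).
      intros H1 H2 H3. generalize (Rmult_le_pos _ _ H3 H2). lra.
    + rewrite cosh_0. field.
  - rewrite sinh_0. field.
Qed.

(** The upper bound uses sinh u >= u + u^3/6, which leaves u^4 / (6 (6 + u^2)). The weaker u^3 is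
    chosen because it cancels the 1/t^3 of the integrand and leaves a pure exponential. *)
Lemma csch_remainder_bound (u : R) : 0 < u -> 0 <= u * csch u - 1 + u ^ 2 / 6 <= u ^ 3.
Proof.
  intros Hu. unfold csch.
  assert (Hc := sinh_ge_cubic u ltac:(lra)).
  assert (Hm := sinh_mul_le u ltac:(lra)).
  assert (Hu3 : 0 < u ^ 3) by now apply pow_lt.
  assert (Hs : 0 < sinh u) by lra.
  assert (Hi : 0 < / sinh u) by now apply Rinv_0_lt_compat.
  split.
  - replace (u * (1 / sinh u) - 1 + u ^ 2 / 6)
      with ((u - sinh u + u ^ 2 * sinh u / 6) * / sinh u) by (field; lra).
    apply Rmult_le_pos; lra.
  - assert (H6 : u * (1 / sinh u) <= 6 / (6 + u ^ 2)).
    { replace (6 / (6 + u ^ 2)) with (u * / (u + u ^ 3 / 6)) by (field; nra).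
      unfold Rdiv at 1. rewrite Rmult_1_l.
      apply Rmult_le_compat_l; [lra|]. apply Rinv_le_contravar; lra. }
    apply Rle_trans with (6 / (6 + u ^ 2) - 1 + u ^ 2 / 6); [lra|].
    replace (6 / (6 + u ^ 2) - 1 + u ^ 2 / 6)
      with (u ^ 3 * (u / (6 * (6 + u ^ 2)))) by (field; nra).
    rewrite <- (Rmult_1_r (u ^ 3)) at 2. apply Rmult_le_compat_l; [lra|].
    apply Rmult_le_reg_r with (6 * (6 + u ^ 2)); [nra|].
    unfold Rdiv. rewrite Rmult_assoc, Rinv_l by nra. nra.
Qed.

Lemma filter_pos_at_right : at_right 0 (fun t => 0 < t).
Proof. exists (mkposreal 1 Rlt_0_1). intros t _ Ht. exact Ht. Qed.

Lemma filter_gt_infty (A : R) : Rbar_locally p_infty (fun t => A < t).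
Proof. exists A. trivial. Qed.

Lemma is_RInt_gen_primitive (G g : R -> R) (la lb : R) :
  (forall t, 0 < t -> is_derive G t (g t)) -> (forall t, 0 < t -> continuous g t) ->
  filterlim G (at_right 0) (locally la) ->
  filterlim G (Rbar_locally p_infty) (locally lb) ->
  is_RInt_gen g (at_right 0) (Rbar_locally p_infty) (lb - la).
Proof.
  intros Hd Hc Ha Hb.
  assert (Hpos : filter_prod (at_right 0) (Rbar_locally p_infty)
    (fun ab : R * R => forall x, Rmin (fst ab) (snd ab) <= x -> 0 < x)).
  { apply Filter_prod with (1 := filter_pos_at_right) (2 := filter_gt_infty 0).
    intros x y Hx Hy t Ht. simpl in Ht.
    assert (0 < Rmin x y) by now apply Rmin_glb_lt. lra. }
  apply is_RInt_gen_ext with (Derive G).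
  - revert Hpos. apply filter_imp. intros [x y] H t [Ht _].
    apply is_derive_unique, Hd, H. now left.
  - apply is_RInt_gen_Derive; [| |exact Ha|exact Hb].
    + revert Hpos. apply filter_imp. intros [x y] H t [Ht _].
      eexists. apply Hd, (H t Ht).
    + revert Hpos. apply filter_imp. intros [x y] H t [Ht _].
      assert (Ht0 := H t Ht).
      apply continuous_ext_loc with g; [|now apply Hc].
      exists (mkposreal t Ht0). intros u Hu.
      change (Rabs (u - t) < t) in Hu. apply Rabs_def2 in Hu.
      symmetry. apply is_derive_unique, Hd. lra.
Qed.

Lemma is_derive_RInt_pos (f : R -> R) (x : R) :
  (forall t, 0 < t -> continuous f t) -> 0 < x ->
  is_derive (fun y => RInt f 1 y) x (f x).
Proof.
  intros Hf Hx. apply (is_derive_RInt f _ 1); [|now apply Hf].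
  exists (mkposreal x Hx). intros u Hu.
  change (Rabs (u - x) < x) in Hu. apply Rabs_def2 in Hu.
  apply (RInt_correct (V := R_CompleteNormedModule)).
  apply (ex_RInt_continuous (V := R_CompleteNormedModule)). intros z [Hz _].
  apply Hf. assert (0 < Rmin 1 u) by (apply Rmin_glb_lt; lra). lra.
Qed.

Lemma filterlim_comparison (F : (R -> Prop) -> Prop) (g G : R -> R) (l : R) :
  ProperFilter F -> F (fun t => 0 < t) ->
  (forall u v, 0 < u -> 0 < v -> Rabs (g u - g v) <= Rabs (G u - G v)) ->
  filterlim G F (locally l) -> exists l', filterlim g F (locally l').
Proof.
  intros HF Hpos Hle HG.
  apply (filterlim_locally_cauchy (U := R_CompleteNormedModule)).
  intros eps. assert (He : 0 < eps / 2) by (generalize (cond_pos eps); lra).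
  exists (fun t => 0 < t /\ Rabs (G t - l) < eps / 2). split.
  - apply filter_and; [exact Hpos|].
    apply (proj1 (filterlim_locally_ball_norm (U := R_NormedModule) G l) HG (mkposreal _ He)).
  - intros u v [Hu Hgu] [Hv Hgv]. change (Rabs (g v - g u) < eps).
    eapply Rle_lt_trans; [now apply Hle|].
    apply Rabs_def2 in Hgu, Hgv. apply Rabs_def1; lra.
Qed.

Lemma filterlim_at_right_0 (g : R -> R) (l : R) : continuous g 0 -> g 0 = l ->
  filterlim g (at_right 0) (locally l).
Proof.
  intros Hg <- P HP. destruct (Hg P HP) as [e He]. exists e. intros t Ht _. now apply He.
Qed.

Lemma is_lim_exp_neg_infty (m : R) : 0 < m ->
  filterlim (fun t => exp (- m * t)) (Rbar_locally p_infty) (locally 0).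
Proof.
  intros Hm. apply (is_lim_comp exp (fun t => - m * t) p_infty 0 m_infty).
  - exact is_lim_exp_m.
  - apply is_lim_spec. intros B. exists (- B / m). intros t Ht.
    apply (Rmult_lt_compat_l m) in Ht; [|exact Hm].
    replace (m * (- B / m)) with (- B) in Ht by (field; lra). lra.
  - exists 0. intros; discriminate.
Qed.

(** The primitive of f based at 1 varies no more than -(K/m) exp(-m t), which has limits at 0 and at
    infinity; so both one-sided limits exist, and integrating the bound gives K/m. *)
Lemma is_RInt_gen_exp_dominated (f : R -> R) (K m : R) : 0 < m ->
  (forall t, 0 < t -> continuous f t) ->
  (forall t, 0 < t -> 0 <= f t <= K * exp (- m * t)) ->
  exists J, is_RInt_gen f (at_right 0) (Rbar_locally p_infty) J /\ Rabs J <= K / m.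
Proof.
  intros Hm Hc Hb.
  set (E := fun t => - (K / m) * exp (- m * t)).
  assert (HE : forall t, is_derive E t (K * exp (- m * t))).
  { intros t. unfold E. auto_derive; [trivial | field; lra]. }
  assert (Hcmp : forall u v, 0 < u -> 0 < v ->
     Rabs (RInt f 1 u - RInt f 1 v) <= Rabs (E u - E v)).
  { intros u v. apply (derive_comparison _ f E (fun t => K * exp (- m * t)) 0).
    - intros t Ht. now apply is_derive_RInt_pos.
    - intros t _. apply HE.
    - intros t Ht. rewrite Rabs_pos_eq; now apply Hb. }
  assert (HE0 : filterlim E (at_right 0) (locally (- (K / m)))).
  { apply filterlim_at_right_0.
    - apply (ex_derive_continuous (V := R_NormedModule)). eexists; apply HE.
    - unfold E. rewrite Rmult_0_r, exp_0. ring. }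
  assert (HEi : filterlim E (Rbar_locally p_infty) (locally 0)).
  { assert (H : is_lim E p_infty (Rbar_mult (- (K / m)) 0)).
    { apply (is_lim_scal_l (fun t => exp (- m * t))). now apply is_lim_exp_neg_infty. }
    simpl in H. rewrite Rmult_0_r in H. exact H. }
  destruct (filterlim_comparison _ (fun y => RInt f 1 y) E _ _ filter_pos_at_right Hcmp HE0)
    as [la Hla].
  destruct (filterlim_comparison _ (fun y => RInt f 1 y) E _ _ (filter_gt_infty 0) Hcmp HEi)
    as [lb Hlb].
  exists (lb - la).
  assert (HJ : is_RInt_gen f (at_right 0) (Rbar_locally p_infty) (lb - la)).
  { apply (is_RInt_gen_primitive (fun y => RInt f 1 y)); trivial.
    intros t Ht. now apply is_derive_RInt_pos. }
  split; [exact HJ|].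
  assert (HK : is_RInt_gen (fun t => K * exp (- m * t)) (at_right 0) (Rbar_locally p_infty)
     (0 - - (K / m))).
  { apply (is_RInt_gen_primitive E); trivial.
    intros t _. apply (ex_derive_continuous (V := R_NormedModule)).
    auto_derive. trivial. }
  replace (K / m) with (0 - - (K / m)) by ring.
  apply (RInt_gen_norm (V := R_CompleteNormedModule) f (fun t => K * exp (- m * t)) _ _
     (Fa := at_right 0) (Fb := Rbar_locally p_infty)).
  - apply Filter_prod with (fun x => 0 < x < 1) (fun y => 1 < y).
    + exists (mkposreal 1 Rlt_0_1). intros t Ht Ht0. split; [exact Ht0|].
      change (Rabs (t - 0) < 1) in Ht. apply Rabs_def2 in Ht. lra.
    + apply filter_gt_infty.
    + intros x y Hx Hy. simpl. lra.
  - apply Filter_prod with (1 := filter_pos_at_right) (2 := filter_gt_infty 0).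
    intros x y Hx Hy t Ht. simpl in Ht. change (Rabs (f t) <= K * exp (- m * t)).
    rewrite Rabs_pos_eq; apply Hb; lra.
  - exact HJ.
  - exact HK.
Qed.

(** * A Frullani integral *)

(** An explicit linear rate, rather than a bare limit, so that linear combinations reduce to
    arithmetic on constants; [decays] plays the same part at infinity. *)
Definition lipschitz_at_0 (g : R -> R) (l : R) : Prop :=
  exists K, forall t, 0 < t < 1 -> Rabs (g t - l) <= K * t.

Lemma lipschitz_at_0_plus (g1 g2 : R -> R) (l1 l2 : R) :
  lipschitz_at_0 g1 l1 -> lipschitz_at_0 g2 l2 ->
  lipschitz_at_0 (fun t => g1 t + g2 t) (l1 + l2).
Proof.
  intros [K1 H1] [K2 H2]. exists (K1 + K2). intros t Ht.
  replace (g1 t + g2 t - (l1 + l2)) with ((g1 t - l1) + (g2 t - l2)) by ring.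
  eapply Rle_trans; [apply Rabs_triang|]. generalize (H1 t Ht) (H2 t Ht). lra.
Qed.

Lemma lipschitz_at_0_scal (c : R) (g : R -> R) (l : R) :
  lipschitz_at_0 g l -> lipschitz_at_0 (fun t => c * g t) (c * l).
Proof.
  intros [K H]. exists (Rabs c * K). intros t Ht.
  rewrite <- Rmult_minus_distr_l, Rabs_mult, Rmult_assoc.
  apply Rmult_le_compat_l; [apply Rabs_pos | now apply H].
Qed.

Lemma lipschitz_at_0_lim (g : R -> R) (l : R) :
  lipschitz_at_0 g l -> filterlim g (at_right 0) (locally l).
Proof.
  intros [K H]. apply (filterlim_locally_ball_norm (U := R_NormedModule)). intros eps.
  assert (Hd : 0 < Rmin 1 (eps / (Rabs K + 1))).
  { apply Rmin_glb_lt; [lra|]. apply Rdiv_lt_0_compat; [apply cond_pos|].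
    generalize (Rabs_pos K). lra. }
  exists (mkposreal _ Hd). intros t Ht Ht0.
  change (Rabs (t - 0) < Rmin 1 (eps / (Rabs K + 1))) in Ht.
  rewrite Rminus_0_r, Rabs_pos_eq in Ht by lra.
  generalize (Rmin_l 1 (eps / (Rabs K + 1))) (Rmin_r 1 (eps / (Rabs K + 1))). intros Hl Hr.
  change (Rabs (g t - l) < eps).
  eapply Rle_lt_trans; [apply H; lra|].
  assert (HK := Rabs_pos K). assert (HK' := Rle_abs K).
  apply Rle_lt_trans with (t * (Rabs K + 1)); [nra|].
  apply Rlt_le_trans with (eps / (Rabs K + 1) * (Rabs K + 1)).
  - apply Rmult_lt_compat_r; lra.
  - right. field. lra.
Qed.

Definition decays (g : R -> R) : Prop :=
  exists K T, forall t, T < t -> Rabs (g t) <= K / t.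

Lemma decays_plus (g1 g2 : R -> R) : decays g1 -> decays g2 ->
  decays (fun t => g1 t + g2 t).
Proof.
  intros [K1 [T1 H1]] [K2 [T2 H2]]. exists (K1 + K2), (Rmax T1 T2). intros t Ht.
  eapply Rle_trans; [apply Rabs_triang|].
  generalize (Rmax_l T1 T2) (Rmax_r T1 T2). intros Hl Hr.
  generalize (H1 t ltac:(lra)) (H2 t ltac:(lra)). unfold Rdiv. lra.
Qed.

Lemma decays_scal (c : R) (g : R -> R) : decays g -> decays (fun t => c * g t).
Proof.
  intros [K [T H]]. exists (Rabs c * K), T. intros t Ht.
  rewrite Rabs_mult. unfold Rdiv. rewrite Rmult_assoc.
  apply Rmult_le_compat_l; [apply Rabs_pos | now apply H].
Qed.

Lemma decays_lim (g : R -> R) : decays g ->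
  filterlim g (Rbar_locally p_infty) (locally 0).
Proof.
  intros [K [T H]]. apply (filterlim_locally_ball_norm (U := R_NormedModule)). intros eps.
  assert (HK := Rabs_pos K). assert (HK' := Rle_abs K). assert (He := cond_pos eps).
  exists (Rmax T ((Rabs K + 1) / eps)). intros t Ht.
  generalize (Rmax_l T ((Rabs K + 1) / eps)) (Rmax_r T ((Rabs K + 1) / eps)). intros Hl Hr.
  assert (Hq : 0 < (Rabs K + 1) / eps) by (apply Rdiv_lt_0_compat; lra).
  assert (Ht0 : 0 < t) by lra.
  change (Rabs (g t - 0) < eps). rewrite Rminus_0_r.
  eapply Rle_lt_trans; [apply H; lra|].
  apply Rmult_lt_reg_r with t; [exact Ht0|].
  replace (K / t * t) with K by (field; lra).
  apply Rle_lt_trans with (Rabs K); [exact HK'|].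
  apply Rlt_trans with (Rabs K + 1); [lra|].
  replace (Rabs K + 1) with (eps * ((Rabs K + 1) / eps)) by (field; lra).
  apply Rmult_lt_compat_l; lra.
Qed.

Lemma exp_neg_le_inv (u : R) : 0 < u -> exp (- u) <= / u.
Proof.
  intros Hu. rewrite exp_Ropp. apply Rinv_le_contravar; [exact Hu|].
  generalize (exp_ineq1_le u). lra.
Qed.

Lemma exp_neg_taylor (u : R) : 0 <= u ->
  0 <= exp (- u) - 1 + u /\ Rabs (exp (- u) - (1 - u + u ^ 2 / 2)) <= u ^ 3 / 6.
Proof.
  assert (H1 : forall v, 0 <= v -> 0 <= 1 - exp (- v)).
  { intros v Hv. cut (exp (- v) <= 1); [lra|]. rewrite <- exp_0.
    destruct (Req_dec v 0) as [-> | Hne]; [rewrite Ropp_0; lra|].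
    left. apply exp_increasing. lra. }
  assert (H2 : forall v, 0 <= v -> 0 <= exp (- v) - 1 + v).
  { intros v. apply (nonneg_of_derive (fun v => exp (- v) - 1 + v) (fun v => 1 - exp (- v))).
    - intros t. auto_derive; [trivial | ring].
    - exact H1.
    - rewrite Ropp_0, exp_0. ring. }
  assert (H3 : forall v, 0 <= v -> 0 <= 1 - v + v ^ 2 / 2 - exp (- v)).
  { intros v. apply (nonneg_of_derive (fun v => 1 - v + v ^ 2 / 2 - exp (- v))
      (fun v => exp (- v) - 1 + v)).
    - intros t. auto_derive; [trivial | field].
    - exact H2.
    - rewrite Ropp_0, exp_0. field. }
  assert (H4 : forall v, 0 <= v -> 0 <= exp (- v) - 1 + v - v ^ 2 / 2 + v ^ 3 / 6).
  { intros v. apply (nonneg_of_derive (fun v => exp (- v) - 1 + v - v ^ 2 / 2 + v ^ 3 / 6)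
      (fun v => 1 - v + v ^ 2 / 2 - exp (- v))).
    - intros t. auto_derive; [trivial | field].
    - exact H3.
    - rewrite Ropp_0, exp_0. field. }
  intros Hu. split; [now apply H2|].
  generalize (H3 u Hu) (H4 u Hu) (pow_le u 3 Hu). intros. apply Rabs_le. lra.
Qed.

(** The exponential integral -E_1(u) up to an additive constant, which cancels since only
    differences of its values are used. *)
Definition exp_int (u : R) : R := RInt (fun t => exp (- t) / t) 1 u.

Lemma is_derive_exp_int (u : R) : 0 < u -> is_derive exp_int u (exp (- u) / u).
Proof.
  apply (is_derive_RInt_pos (fun t => exp (- t) / t)).
  intros t Ht. apply (ex_derive_continuous (V := R_NormedModule)).
  auto_derive. lra.
Qed.

(** The Frullani limit: [exp_int] minus ln has derivative (exp(-u) - 1)/u, of absolute value at most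
    1, so it is 1-Lipschitz and ln(x t) - ln(y t) gives the limit. *)
Lemma exp_int_at_0 (x y : R) : 0 < x -> 0 < y ->
  lipschitz_at_0 (fun t => exp_int (x * t) - exp_int (y * t)) (ln x - ln y).
Proof.
  intros Hx Hy. exists (Rabs (x - y)). intros t Ht.
  assert (Hxt : 0 < x * t) by (apply Rmult_lt_0_compat; lra).
  assert (Hyt : 0 < y * t) by (apply Rmult_lt_0_compat; lra).
  replace (exp_int (x * t) - exp_int (y * t) - (ln x - ln y))
    with ((exp_int (x * t) - ln (x * t)) - (exp_int (y * t) - ln (y * t))).
  2:{ rewrite !ln_mult by lra. ring. }
  replace (Rabs (x - y) * t) with (Rabs (x * t - y * t)).
  2:{ rewrite <- Rmult_minus_distr_r, Rabs_mult, (Rabs_pos_eq t); lra. }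
  apply (derive_comparison (fun u => exp_int u - ln u) (fun u => exp (- u) / u - / u)
    (fun u => u) (fun _ => 1) 0); trivial.
  - intros u Hu. apply (is_derive_minus (V := R_NormedModule)).
    + now apply is_derive_exp_int.
    + now apply is_derive_ln.
  - intros u _. apply (is_derive_id (K := R_AbsRing)).
  - intros u Hu. destruct (exp_neg_taylor u) as [H _]; [lra|].
    assert (exp (- u) <= 1).
    { rewrite <- exp_0. left. apply exp_increasing. lra. }
    replace (exp (- u) / u - / u) with (- ((1 - exp (- u)) * / u)) by (field; lra).
    assert (0 < / u) by now apply Rinv_0_lt_compat.
    rewrite Rabs_Ropp, Rabs_pos_eq by (apply Rmult_le_pos; lra).
    apply Rle_trans with (u * / u); [apply Rmult_le_compat_r | rewrite Rinv_r]; lra.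
Qed.

Lemma exp_int_decays (x y : R) : 0 < x -> 0 < y ->
  decays (fun t => exp_int (x * t) - exp_int (y * t)).
Proof.
  intros Hx Hy. exists (/ x + / y), (/ x + / y). intros t Ht.
  assert (Hix := Rinv_0_lt_compat _ Hx). assert (Hiy := Rinv_0_lt_compat _ Hy).
  assert (Hxt : 1 < x * t).
  { rewrite <- (Rinv_r x) by lra. apply Rmult_lt_compat_l; lra. }
  assert (Hyt : 1 < y * t).
  { rewrite <- (Rinv_r y) by lra. apply Rmult_lt_compat_l; lra. }
  apply Rle_trans with (Rabs (- exp (- (x * t)) - - exp (- (y * t)))).
  - apply (derive_comparison exp_int (fun u => exp (- u) / u)
      (fun u => - exp (- u)) (fun u => exp (- u)) 1); trivial.
    + intros u Hu. apply is_derive_exp_int. lra.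
    + intros u _. auto_derive; [trivial | ring].
    + intros u Hu. assert (He := exp_pos (- u)).
      assert (Hi : / u <= 1) by (rewrite <- Rinv_1; apply Rinv_le_contravar; lra).
      assert (0 < / u) by (apply Rinv_0_lt_compat; lra).
      unfold Rdiv. rewrite Rabs_pos_eq by (apply Rmult_le_pos; lra).
      rewrite <- (Rmult_1_r (exp (- u))) at 2. apply Rmult_le_compat_l; lra.
  - replace ((/ x + / y) / t) with (/ (x * t) + / (y * t)) by (field; repeat split; lra).
    generalize (exp_neg_le_inv (x * t) ltac:(lra)) (exp_neg_le_inv (y * t) ltac:(lra)).
    generalize (exp_pos (- (x * t))) (exp_pos (- (y * t))). intros.
    apply Rabs_le. lra.
Qed.

(** With s = sqrt beta and m = 1 this is the integrand of the theorem; general m allows the shift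
    from m to m + 2s. *)
Definition csch_integrand (s m t : R) : R :=
  exp (- m * t) / t ^ 3 * (s * t * csch (s * t) - 1 + s ^ 2 * t ^ 2 / 6).

Lemma sinh_pos (u : R) : 0 < u -> 0 < sinh u.
Proof. intros Hu. generalize (sinh_ge_id u ltac:(lra)). lra. Qed.

Lemma csch_integrand_continuous (s m t : R) : 0 < s -> 0 < t ->
  continuous (csch_integrand s m) t.
Proof.
  intros Hs Ht. apply (ex_derive_continuous (V := R_NormedModule)).
  assert (H := sinh_pos (s * t) ltac:(apply Rmult_lt_0_compat; lra)).
  unfold csch_integrand, csch, sinh in *. auto_derive.
  repeat split; try lra. assert (0 < t ^ 3) by now apply pow_lt. simpl in *. lra.
Qed.

Lemma csch_integrand_bound (s m t : R) : 0 < s -> 0 < t ->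
  0 <= csch_integrand s m t <= s ^ 3 * exp (- m * t).
Proof.
  intros Hs Ht. unfold csch_integrand.
  assert (Hst : 0 < s * t) by (apply Rmult_lt_0_compat; lra).
  destruct (csch_remainder_bound (s * t) Hst) as [H1 H2].
  assert (Ht3 : 0 < t ^ 3) by now apply pow_lt.
  assert (He : 0 < exp (- m * t) / t ^ 3) by (apply Rdiv_lt_0_compat; [apply exp_pos | lra]).
  replace (s ^ 2 * t ^ 2) with ((s * t) ^ 2) by ring.
  split.
  - apply Rmult_le_pos; lra.
  - replace (s ^ 3 * exp (- m * t)) with (exp (- m * t) / t ^ 3 * (s * t) ^ 3)
      by (field; lra).
    apply Rmult_le_compat_l; lra.
Qed.

(** The explicit 1/m in the bound is what makes the remainder of the telescoping sum vanish. *)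
Lemma csch_integral_ex (s m : R) : 0 < s -> 0 < m ->
  exists J, is_RInt_gen (csch_integrand s m) (at_right 0) (Rbar_locally p_infty) J
    /\ Rabs J <= s ^ 3 / m.
Proof.
  intros Hs Hm. apply is_RInt_gen_exp_dominated; [exact Hm| |].
  - intros t Ht. now apply csch_integrand_continuous.
  - intros t Ht. now apply csch_integrand_bound.
Qed.

(** Boundary terms from integrating by parts the 1/t^2 and 1/t^3 terms of the difference of
    integrands, down to integrals of exp(-x t)/t. *)
Definition csch_boundary (m s t : R) : R :=
  - 2 * s * exp (- (m + s) * t) / t
  + (exp (- m * t) / (2 * t ^ 2) - m * exp (- m * t) / (2 * t))
  - (exp (- (m + 2 * s) * t) / (2 * t ^ 2)
     - (m + 2 * s) * exp (- (m + 2 * s) * t) / (2 * t)).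

Lemma exp_remainder_ex (x t : R) : 0 < x -> 0 < t -> exists k,
  exp (- x * t) = 1 - x * t + x ^ 2 * t ^ 2 / 2 + t ^ 3 * k /\ Rabs k <= x ^ 3 / 6.
Proof.
  intros Hx Ht. assert (Ht3 : 0 < t ^ 3) by now apply pow_lt.
  destruct (exp_neg_taylor (x * t)) as [_ H]; [apply Rmult_le_pos; lra|].
  replace (- (x * t)) with (- x * t) in H by ring.
  exists ((exp (- x * t) - (1 - x * t + (x * t) ^ 2 / 2)) / t ^ 3). split.
  - field. lra.
  - unfold Rdiv at 1. rewrite Rabs_mult, (Rabs_pos_eq (/ t ^ 3)).
    2:{ left. now apply Rinv_0_lt_compat. }
    apply Rmult_le_reg_r with (t ^ 3); [exact Ht3|].
    rewrite Rmult_assoc, Rinv_l, Rmult_1_r by lra.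
    replace (x ^ 3 / 6 * t ^ 3) with ((x * t) ^ 3 / 6) by field. exact H.
Qed.

(** The poles in 1/t^2 and 1/t cancel between the three exponentials; second-order Taylor
    polynomials with cubic remainder give the limit and the linear rate. *)
Lemma csch_boundary_at_0 (m s : R) : 0 < m -> 0 < s ->
  lipschitz_at_0 (csch_boundary m s) (- s * (m + s)).
Proof.
  intros Hm Hs. set (p := m + s). set (q := m + 2 * s).
  (* The coefficient of t produced by the Taylor polynomials; the other constants bound their
     remainders. *)
  set (c := - s * p ^ 2 - m ^ 3 / 4 + q ^ 3 / 4).
  exists (Rabs c + 2 * s * (p ^ 3 / 6) + m ^ 3 / 6 + m * (m ^ 3 / 6)
          + q ^ 3 / 6 + q * (q ^ 3 / 6)).
  intros t Ht.
  destruct (exp_remainder_ex p t) as [kp [Ep Hp]]; [unfold p; lra | lra |].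
  destruct (exp_remainder_ex m t) as [km [Em Hkm]]; [lra | lra |].
  destruct (exp_remainder_ex q t) as [kq [Eq Hq]]; [unfold q; lra | lra |].
  replace (csch_boundary m s t - - s * p)
    with ((c + - (2 * s * (t * kp)) + km / 2 + - (m * (t * km)) / 2
           + - kq / 2 + q * (t * kq) / 2) * t).
  2:{ unfold csch_boundary. fold p q. rewrite Ep, Em, Eq. unfold c, p, q. field. lra. }
  rewrite Rabs_mult, (Rabs_pos_eq t) by lra.
  apply Rmult_le_compat_r; [lra|].
  assert (Hmul : forall y k b, 0 <= y -> Rabs k <= b -> Rabs (y * (t * k)) <= y * b).
  { intros y k b Hy Hk. rewrite !Rabs_mult, (Rabs_pos_eq y), (Rabs_pos_eq t) by lra.
    apply Rmult_le_compat_l; [exact Hy|].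
    apply Rle_trans with (1 * Rabs k); [|lra].
    apply Rmult_le_compat_r; [apply Rabs_pos | lra]. }
  assert (H1 := Hmul (2 * s) kp _ ltac:(lra) Hp).
  assert (H2 := Hmul m km _ ltac:(lra) Hkm).
  assert (H3 := Hmul q kq _ ltac:(unfold q; lra) Hq).
  apply Rabs_le_between in Hkm, Hq, H1, H2, H3.
  assert (Hc1 := Rle_abs c). assert (Hc2 := Rle_abs (- c)). rewrite Rabs_Ropp in Hc2.
  apply Rabs_le. lra.
Qed.

Lemma exp_over_decays (x c : R) : 0 < x -> decays (fun t => c * (exp (- x * t) / t)).
Proof.
  intros Hx. apply (decays_scal c). exists 1, 0. intros t Ht.
  assert (He : exp (- x * t) <= 1).
  { rewrite <- exp_0. left. apply exp_increasing. nra. }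
  assert (Hp := exp_pos (- x * t)).
  assert (0 < / t) by now apply Rinv_0_lt_compat.
  unfold Rdiv. rewrite Rabs_pos_eq by (apply Rmult_le_pos; lra).
  apply Rmult_le_compat_r; lra.
Qed.

Lemma exp_over_sqr_decays (x c : R) : 0 < x -> decays (fun t => c * (exp (- x * t) / t ^ 2)).
Proof.
  intros Hx. apply (decays_scal c). exists 1, 1. intros t Ht.
  assert (He : exp (- x * t) <= 1).
  { rewrite <- exp_0. left. apply exp_increasing. nra. }
  assert (Hp := exp_pos (- x * t)).
  assert (Hi : 0 < / t) by (apply Rinv_0_lt_compat; lra).
  assert (Hi1 : / t <= 1) by (rewrite <- Rinv_1; apply Rinv_le_contravar; lra).
  unfold Rdiv. rewrite <- pow_inv. simpl. rewrite Rmult_1_r.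
  rewrite Rabs_pos_eq by (apply Rmult_le_pos; [lra | apply Rmult_le_pos; lra]).
  apply Rmult_le_compat; [lra | apply Rmult_le_pos; lra | lra | nra].
Qed.

Lemma decays_ext (f g : R -> R) : (forall t, 0 < t -> f t = g t) -> decays f -> decays g.
Proof.
  intros E [K [T H]]. exists K, (Rmax T 0). intros t Ht.
  generalize (Rmax_l T 0) (Rmax_r T 0). intros Hl Hr.
  rewrite <- E by lra. apply H. lra.
Qed.

Lemma csch_boundary_decays (m s : R) : 0 < m -> 0 < s -> decays (csch_boundary m s).
Proof.
  intros Hm Hs. set (p := m + s). set (q := m + 2 * s).
  assert (Hp : 0 < p) by (unfold p; lra). assert (Hq : 0 < q) by (unfold q; lra).
  apply decays_ext with (2 :=
    decays_plus _ _ (exp_over_decays p (- 2 * s) Hp)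
     (decays_plus _ _
       (decays_plus _ _ (exp_over_sqr_decays m (/ 2) Hm) (exp_over_decays m (- m / 2) Hm))
       (decays_plus _ _ (exp_over_sqr_decays q (- / 2) Hq) (exp_over_decays q (q / 2) Hq)))).
  intros t Ht. unfold csch_boundary. fold p q. field. lra.
Qed.

(** Integration by parts leaves the coefficient -2s(m+s) on the exponential integral at m + s. It is
    minus the sum of the other two coefficients, so everything pairs into differences with Frullani
    limits. *)
Definition csch_primitive (m s t : R) : R :=
  csch_boundary m s t
  + ((- m ^ 2 / 2 + s ^ 2 / 6) * (exp_int (m * t) - exp_int ((m + s) * t))
     + ((m + 2 * s) ^ 2 / 2 - s ^ 2 / 6)
       * (exp_int ((m + 2 * s) * t) - exp_int ((m + s) * t))).

Lemma is_derive_csch_primitive (m s t : R) : 0 < m -> 0 < s -> 0 < t ->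
  is_derive (csch_primitive m s) t
    (csch_integrand s m t - csch_integrand s (m + 2 * s) t).
Proof.
  intros Hm Hs Ht.
  assert (Hd : forall x, 0 < x -> is_derive exp_int (x * t) (exp (- x * t) / (x * t))).
  { intros x Hx. replace (- x * t) with (- (x * t)) by ring.
    apply is_derive_exp_int, Rmult_lt_0_compat; lra. }
  assert (Hdm := Hd m Hm). assert (Hdp := Hd (m + s) ltac:(lra)).
  assert (Hdq := Hd (m + 2 * s) ltac:(lra)).
  unfold csch_primitive, csch_boundary. auto_derive.
  - repeat split; try (eexists; eassumption); try lra;
      simpl; repeat apply Rmult_integral_contrapositive_currified; lra.
  - assert (HD : forall x, 0 < x ->
      Derive (fun u : R => exp_int u) (x * t) = exp (- x * t) / (x * t)).
    { intros x Hx. now apply is_derive_unique, Hd. }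
    rewrite (HD m Hm), (HD (m + s) ltac:(lra)), (HD (m + 2 * s) ltac:(lra)).
    assert (Hsh := sinh_pos (s * t) ltac:(apply Rmult_lt_0_compat; lra)).
    unfold csch_integrand, csch, sinh in *.
    (* In terms of E and A every exponential is rational, and the identity becomes one between
       rational functions; csch contributes the denominator A^2 - 1. *)
    set (E := exp (- (m + s) * t)). set (A := exp (s * t)) in *.
    assert (HA : 0 < A) by apply exp_pos.
    assert (EA : exp (- (s * t)) = / A) by (unfold A; apply exp_Ropp).
    rewrite EA in *.
    assert (Em : exp (- m * t) = E * A).
    { unfold E, A. rewrite <- exp_plus. f_equal. ring. }
    assert (Eq : exp (- (m + 2 * s) * t) = E * / A).
    { rewrite <- EA. unfold E. rewrite <- exp_plus. f_equal. ring. }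
    rewrite Em, Eq.
    assert (HA2 : A * A - 1 <> 0).
    { intros H0. assert (A - / A = 0); [|lra].
      replace (A - / A) with ((A * A - 1) * / A) by (field; lra). rewrite H0. ring. }
    field. repeat split; try lra.
Qed.

Lemma csch_integral_diff (s m J1 J2 : R) : 0 < s -> 0 < m ->
  is_RInt_gen (csch_integrand s m) (at_right 0) (Rbar_locally p_infty) J1 ->
  is_RInt_gen (csch_integrand s (m + 2 * s)) (at_right 0) (Rbar_locally p_infty) J2 ->
  J1 - J2 = s * (m + s) + (m ^ 2 / 2 - s ^ 2 / 6) * (ln m - ln (m + s))
    - ((m + 2 * s) ^ 2 / 2 - s ^ 2 / 6) * (ln (m + 2 * s) - ln (m + s)).
Proof.
  intros Hs Hm H1 H2.
  set (cm := - m ^ 2 / 2 + s ^ 2 / 6). set (cq := (m + 2 * s) ^ 2 / 2 - s ^ 2 / 6).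
  assert (Hd := is_RInt_gen_minus _ _ _ _ H1 H2).
  assert (Hp : is_RInt_gen (fun t => csch_integrand s m t - csch_integrand s (m + 2 * s) t)
     (at_right 0) (Rbar_locally p_infty)
     (0 - (- s * (m + s) + (cm * (ln m - ln (m + s)) + cq * (ln (m + 2 * s) - ln (m + s)))))).
  { apply (is_RInt_gen_primitive (csch_primitive m s)).
    - intros t Ht. now apply is_derive_csch_primitive.
    - intros t Ht. apply (continuous_minus (V := R_NormedModule));
        now apply csch_integrand_continuous.
    - apply lipschitz_at_0_lim. unfold csch_primitive.
      apply lipschitz_at_0_plus; [now apply csch_boundary_at_0|].
      apply lipschitz_at_0_plus; apply lipschitz_at_0_scal, exp_int_at_0; lra.
    - apply decays_lim. unfold csch_primitive.
      apply decays_plus; [now apply csch_boundary_decays|].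
      apply decays_plus; apply decays_scal, exp_int_decays; lra. }
  assert (E := eq_trans (eq_sym (is_RInt_gen_unique _ _ Hd)) (is_RInt_gen_unique _ _ Hp)).
  change (minus J1 J2) with (J1 - J2) in E.
  rewrite E. unfold cm, cq. field.
Qed.

(** For m = 1 + 2sN and a = 1/(2s), the numbers m, m + s and m + 2s are 2s times a + N, a + N + 1/2
    and a + N + 1. In these terms each difference is one step of the midpoint formula for u ln u,
    and ln(2s) drops out. *)
Lemma csch_integral_telescope (s : R) (N : nat) (J0 JN : R) : 0 < s ->
  is_RInt_gen (csch_integrand s 1) (at_right 0) (Rbar_locally p_infty) J0 ->
  is_RInt_gen (csch_integrand s (1 + 2 * s * INR N)) (at_right 0) (Rbar_locally p_infty) JN ->
  J0 - JN = 4 * s ^ 2 *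
    (midpoint_primitive (/ (2 * s)) - midpoint_primitive (/ (2 * s) + INR N)
     + bsum (fun n => (/ (2 * s) + INR n + / 2) * ln (/ (2 * s) + INR n + / 2)) N).
Proof.
  intros Hs H0. revert JN. induction N as [|N IH]; intros JN HN.
  - change (INR 0) with 0 in *. rewrite Rmult_0_r, Rplus_0_r in HN. rewrite (Rplus_0_r (/ (2 * s))).
    assert (E := eq_trans (eq_sym (is_RInt_gen_unique _ _ H0)) (is_RInt_gen_unique _ _ HN)).
    simpl bsum. rewrite E. ring.
  - assert (Hm : 0 < 1 + 2 * s * INR N).
    { assert (0 <= 2 * s * INR N) by (apply Rmult_le_pos; [lra | apply pos_INR]). lra. }
    destruct (csch_integral_ex s _ Hs Hm) as [J [HJ _]].
    rewrite S_INR in *.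
    replace (1 + 2 * s * (INR N + 1)) with (1 + 2 * s * INR N + 2 * s) in HN by ring.
    assert (E := csch_integral_diff _ _ _ _ Hs Hm HJ HN).
    specialize (IH J HJ).
    replace (J0 - JN) with ((J0 - J) + (J - JN)) by ring. rewrite IH, E. clear IH E.
    simpl bsum.
    set (m := 1 + 2 * s * INR N) in *.
    replace (/ (2 * s) + INR N + / 2) with ((m + s) / (2 * s)) by (unfold m; field; lra).
    replace (/ (2 * s) + (INR N + 1)) with ((m + 2 * s) / (2 * s)) by (unfold m; field; lra).
    replace (/ (2 * s) + INR N) with (m / (2 * s)) by (unfold m; field; lra).
    unfold midpoint_primitive. rewrite !ln_div by lra.
    field. lra.
Qed.

Lemma csch_integral_value (s Z : R) : 0 < s ->
  is_lim_seq (fun N => midpoint_primitive (/ (2 * s) + INR N)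
    - bsum (fun n => (/ (2 * s) + INR n + / 2) * ln (/ (2 * s) + INR n + / 2)) N) Z ->
  is_RInt_gen (csch_integrand s 1) (at_right 0) (Rbar_locally p_infty)
    (4 * s ^ 2 * (midpoint_primitive (/ (2 * s)) - Z)).
Proof.
  intros Hs HZ. destruct (csch_integral_ex s 1 Hs Rlt_0_1) as [J [HJ _]].
  set (a := / (2 * s)) in *. assert (Ha : 0 < a) by (apply Rinv_0_lt_compat; lra).
  set (v := fun N => midpoint_primitive (a + INR N)
    - bsum (fun n => (a + INR n + / 2) * ln (a + INR n + / 2)) N) in *.
  assert (Hv : is_lim_seq (fun N => 4 * s ^ 2 * (midpoint_primitive a - v N))
                (4 * s ^ 2 * (midpoint_primitive a - Z))).
  { apply is_lim_seq_mult'; [apply is_lim_seq_const|].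
    apply is_lim_seq_minus'; [apply is_lim_seq_const | exact HZ]. }
  (* The sequence is the integral left after N shifts, at most s^3/(1 + 2sN) = (s^2/2)/(a + N) in
     absolute value. *)
  assert (Hd : is_lim_seq (fun N => J - 4 * s ^ 2 * (midpoint_primitive a - v N)) 0).
  { apply is_lim_seq_abs_0.
    apply is_lim_seq_le_le with (fun _ => 0)
      (fun N => s ^ 2 / 2 * exp (- (1) * ln (a + INR N))).
    - intros N. split; [apply Rabs_pos|].
      assert (HN : 0 < a + INR N) by (generalize (pos_INR N); lra).
      assert (Hm : 0 < 1 + 2 * s * INR N).
      { assert (0 <= 2 * s * INR N) by (apply Rmult_le_pos; [lra | apply pos_INR]). lra. }
      destruct (csch_integral_ex s _ Hs Hm) as [JN [HJN Hb]].
      assert (E := csch_integral_telescope s N J JN Hs HJ HJN). fold a in E.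
      replace (J - 4 * s ^ 2 * (midpoint_primitive a - v N)) with JN.
      2:{ unfold v. lra. }
      replace (- (1) * ln (a + INR N)) with (- ln (a + INR N)) by ring.
      rewrite exp_Ropp, exp_ln by exact HN.
      replace (s ^ 2 / 2 * / (a + INR N)) with (s ^ 3 / (1 + 2 * s * INR N)); [exact Hb|].
      unfold a. field. repeat split; lra.
    - apply is_lim_seq_const.
    - replace 0 with (s ^ 2 / 2 * 0) by ring.
      apply is_lim_seq_mult'; [apply is_lim_seq_const|].
      apply is_lim_seq_exp_neg_ln; lra. }
  assert (HJ' : is_lim_seq (fun _ : nat => J) (0 + 4 * s ^ 2 * (midpoint_primitive a - Z))).
  { eapply is_lim_seq_ext; [|apply (is_lim_seq_plus' _ _ _ _ Hd Hv)].
    intros N. cbv beta. ring. }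
  apply is_lim_seq_unique in HJ'. rewrite Lim_seq_const in HJ'.
  apply Rbar_finite_eq in HJ'. rewrite Rplus_0_l in HJ'. rewrite <- HJ'. exact HJ.
Qed.

Theorem mainTheorem2 (zeta : C -> R -> C) (hzeta : is_Hurwitz_zeta zeta)
    (beta : R) (hbeta : 0 < beta) :
  exists I : R,
    is_RInt_gen
      (fun tau : R =>
         exp (- tau) / tau ^ 3 *
         (sqrt beta * tau * csch (sqrt beta * tau) - 1 + beta * tau ^ 2 / 6))
      (at_right 0) (Rbar_locally p_infty) I /\
    RtoC I =
      (RtoC (beta * ln beta / 12 - ln beta / 4
             + beta * (ln 4 / 12 - 1 / 6) - ln 4 / 4 - 1 / 4)
       - RtoC (4 * beta)
         * C_derive (fun z : C => zeta z ((1 + sqrt beta) / (2 * sqrt beta))%R)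
             (RtoC (-1)))%C.
Proof.
  set (s := sqrt beta). assert (Hs : 0 < s) by now apply sqrt_lt_R0.
  assert (Hb : beta = s ^ 2) by (unfold s; rewrite pow2_sqrt; lra).
  set (a := / (2 * s)). assert (Ha : 0 < a) by (apply Rinv_0_lt_compat; lra).
  destruct (hurwitz_derive_lim a Ha zeta hzeta) as [Z [HZ Hlim]].
  (* The second argument of zeta is the midpoint of the first unit interval starting at a. *)
  replace ((1 + s) / (2 * s)) with (a + / 2) by (unfold a; field; lra).
  rewrite HZ, <- RtoC_mult, <- RtoC_minus.
  eexists. split.
  - apply is_RInt_gen_ext with (2 := csch_integral_value s Z Hs Hlim).
    apply Filter_prod with (1 := filter_pos_at_right) (2 := filter_gt_infty 0).
    intros x y _ _ t _. unfold csch_integrand. rewrite Hb.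
    now replace (- (1) * t) with (- t) by ring.
  - f_equal. fold a.
    (* From 4 beta = (2s)^2 = a^(-2); this is where ln 4 enters the closed form. *)
    assert (Hla : ln a = - (ln 4 + ln beta) / 2).
    { replace (ln 4 + ln beta) with (2 * ln (2 * s)).
      - unfold a. rewrite ln_Rinv by lra. field.
      - rewrite <- ln_mult by lra. replace (4 * beta) with ((2 * s) ^ 2) by (rewrite Hb; ring).
        rewrite <- (exp_ln (2 * s)) at 2 by lra.
        replace (exp (ln (2 * s)) ^ 2) with (exp (2 * ln (2 * s))); [now rewrite ln_exp|].
        simpl. rewrite Rmult_1_r, <- exp_plus. f_equal. ring. }
    unfold midpoint_primitive. rewrite Hla.
    replace (a ^ 2) with (/ (4 * beta)) by (unfold a; rewrite Hb; field; lra).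
    rewrite <- Hb. field. lra.
Qed.
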